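(* Let $\mathfrak T$ be a tower type of degree $n$ and $K$ a number field of degree $n$ such that $\mathcal S(\mathfrak T,K)$ is nonempty. Then $\mathrm{Len}(\mathfrak T)\subseteq\mathrm{Spe}(\mathcal S(\mathfrak T,K))$.
   Context: $|x|=\sqrt{\frac1n\sum_m|\sigma_m(x)|^2}$ over the complex embeddings; $\lambda_i(\Lambda)=\min\{r>0:\dim_{\mathbb Q}\mathrm{Span}_{\mathbb Q}\{x\in\Lambda:|x|\le r\}\ge i+1\}$. A tower type is $(n_1,\dots,n_t)$, $n_s>1$, degree $\prod n_s$; the tower type of an order $\mathcal O$ in $K$ is $([K_1:K_0],\dots,[K_t:K_{t-1}])$ where $\mathbb Q=K_0\subset\dots\subset K_t=K$ are exactly the fields $\mathbb Q(\{x\in\mathcal O:|x|\le r\})$, $r>0$. $\mathcal S(\mathfrak T,K)$: isomorphism classes of orders in $K$ with tower type $\mathfrak T$. Minkowski type of an infinite set $\mathcal S$: limit of $(\log_{\Delta_{\mathcal O}}\lambda_1(\mathcal O),\dots,\log_{\Delta_{\mathcal O}}\lambda_{n-1}(\mathcal O))$ over $\mathcal O\in\mathcal S$, $\Delta_{\mathcal O}$ the absolute discriminant; $\mathrm{Spe}(\mathcal S)$ is the set of Minkowski types of infinite subsets of $\mathcal S$. Mixed radix: $m=m_1+m_2n_1+\dots+m_tn_1\cdots n_{t-1}$, $0\le m_s<n_s$; $i+j=k$ does not overflow modulo $\mathfrak T$ if $i_s+j_s=k_s$ for all $s$. The Lenstra polytope $\mathrm{Len}(\mathfrak T)$ is the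 set of $\mathbf x\in\mathbb R^{n-1}$ with $\sum x_i=1/2$, $0\le x_1\le\dots\le x_{n-1}$, and $x_{i+j}\le x_i+x_j$ whenever $i,j\ge1$, $i+j<n$ and $i+j$ does not overflow modulo $\mathfrak T$. *)

(* Defs.v *)
From HB Require Import structures.
From mathcomp Require Import all_boot all_order all_algebra all_field.
From mathcomp Require Import all_classical all_reals all_analysis.
From mathcomp Require Import complex.

Set Implicit Arguments.
Unset Strict Implicit.
Unset Printing Implicit Defensive.

Import Order.TTheory GRing.Theory Num.Theory.
Import numFieldNormedType.Exports.
Local Open Scope classical_set_scope.
Local Open Scope ring_scope.

(* A tower type is a finite sequence of integers > 1; its degree is their
   product.  The empty sequence is allowed: its degree is 1. *)
Definition is_tower_type (T : seq nat) : Prop := all (fun m => 1 < m)%N T.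

Definition tower_degree (T : seq nat) : nat := (\prod_(m <- T) m)%N.

(* Mixed radix digits; [s] counts from 0, so this is m_(s+1). *)
Definition radix_weight (T : seq nat) (s : nat) : nat :=
  (\prod_(m <- take s T) m)%N.

Definition digit (T : seq nat) (s m : nat) : nat :=
  ((m %/ radix_weight T s) %% nth 1 T s)%N.

Lemma radix_weight_gt0 T s : is_tower_type T -> (0 < radix_weight T s)%N.
Proof.
move=> /allP hT; rewrite /radix_weight big_seq prodn_cond_gt0 // => m /mem_take.
by move=> /hT /ltnW.
Qed.

Lemma digit_lt T s m : is_tower_type T -> (s < size T)%N ->
  (digit T s m < nth 1 T s)%N.
Proof.
by move=> /allP hT hs; rewrite ltn_mod ltnW// hT// mem_nth.
Qed.

Lemma digit_sum T m : is_tower_type T -> (m < tower_degree T)%N ->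
  m = (\sum_(s < size T) digit T s m * radix_weight T s)%N.
Proof.
move=> hT hm.
have step k : (k <= size T)%N ->
    (m %% radix_weight T k = \sum_(s < k) digit T s m * radix_weight T s)%N.
  elim: k => [_|k IH hk].
    by rewrite big_ord0 /radix_weight take0 big_nil modn1.
  rewrite big_ord_recr /= -IH 1?ltnW//.
  have -> : radix_weight T k.+1 = (radix_weight T k * nth 1 T k)%N.
    by rewrite /radix_weight (take_nth 1%N)// -cats1 big_cat big_seq1.
  have := radix_weight_gt0 k hT; rewrite /digit.
  move: (radix_weight T k) (nth 1 T k) => w p w0.
  rewrite {1}(divn_eq m w) {1}(divn_eq (m %/ w) p) mulnDl -addnA.
  rewrite -mulnA [(p * w)%N]mulnC modnMDl addnC.
  have [->|p0] := posnP p; first by rewrite muln0 modn0.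
  rewrite modn_small//.
  have lt1 : (m %% w < w)%N by rewrite ltn_mod.
  have lt2 : (m %/ w %% p < p)%N by rewrite ltn_mod.
  apply: (@leq_trans ((m %/ w %% p).+1 * w)).
    by rewrite mulSn ltn_add2r.
  by rewrite mulnC leq_mul2l lt2 orbT.
rewrite -step// modn_small//.
by rewrite /radix_weight take_size.
Qed.

Definition no_overflow (T : seq nat) (i j : nat) : Prop :=
  forall s, (s < size T)%N -> (digit T s i + digit T s j = digit T s (i + j))%N.

(* The coordinate x_i, 1 <= i < n, is the entry of index i - 1. *)
Definition Len (R : realType) (T : seq nat) (n : nat) : set 'rV[R]_n.-1 :=
  [set x : 'rV[R]_n.-1 | [/\ \sum_i x ord0 i = 2^-1,
               (forall i, 0 <= x ord0 i),
               (forall i j : 'I_n.-1, (i <= j)%N -> x ord0 i <= x ord0 j) &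
               forall i j k : 'I_n.-1, (i.+1 + j.+1 = k.+1)%N ->
                 no_overflow T i.+1 j.+1 ->
                 x ord0 k <= x ord0 i + x ord0 j]].

Section NumberField.
Variables (R : realType) (K : fieldExtType rat).

Definition embeddings : set (K -> R[i]) :=
  [set f : K -> R[i] | exists s : {rmorphism K -> R[i]}, f = (s : K -> R[i])].

Definition len (x : K) : R :=
  Num.sqrt ((\dim {:K})%:R^-1 *
            \sum_(f \in embeddings) Normc.normc (f x) ^+ 2).

Definition Qspan (A : set K) : {vspace K} :=
  xget 0%VS [set U : {vspace K} | A `<=` [set` U] /\
    forall V : {vspace K}, A `<=` [set` V] -> (U <= V)%VS].

Definition Qfield (A : set K) : {subfield K} :=
  xget 1%AS [set F : {subfield K} | A `<=` [set` F] /\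
    forall E : {subfield K}, A `<=` [set` E] -> (F <= E)%VS].

Definition minimum (A : set R) : R := xget 0 [set m : R | A m /\ lbound A m].

Definition short (L : set K) (r : R) : set K := [set x : K | L x /\ len x <= r].

Definition lambda (i : nat) (L : set K) : R :=
  minimum [set r : R | 0 < r /\ (i.+1 <= \dim (Qspan (short L r)))%N].

Definition is_Zbasis (L : set K) (b : (\dim {:K}).-tuple K) : Prop :=
  basis_of {:K} b /\
  L = [set x : K | exists c : 'I_(\dim {:K}) -> int, x = \sum_i tnth b i *~ c i].

Definition is_order (O : set K) : Prop :=
  [/\ O 1, (forall x y, O x -> O y -> O (x - y)),
      (forall x y, O x -> O y -> O (x * y)) & exists b, is_Zbasis O b].

Definition trace (x : K) : rat :=
  \tr (passmx.mxof (vbasis {:K}) (vbasis {:K}) (amull x)).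

Definition absdisc (O : set K) : rat :=
  xget 0 [set D : rat | exists b, is_Zbasis O b /\
    D = `|\det (\matrix_(i, j) trace (tnth b i * tnth b j))|].

(* [Ks] is K_1, ..., K_t; the field K_0 = Q is [1%AS]. *)
Definition has_tower_type (O : set K) (T : seq nat) : Prop :=
  exists Ks : seq {subfield K},
    [/\ path (fun E F : {subfield K} => (E <= F)%VS && (E != F)) 1%AS Ks,
        last 1%AS Ks = {:K}%AS,
        [set` 1%AS :: Ks] =
          [set F : {subfield K} | exists2 r : R, 0 < r & F = Qfield (short O r)] &
        T = pairmap (fun E F : {subfield K} => \dim_E F) 1%AS Ks].

Definition order_iso (O O' : set K) : Prop :=
  exists f : K -> K,
    [/\ set_bij O O' f, f 1 = 1,
        (forall x y, O x -> O y -> f (x + y) = f x + f y) &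
        (forall x y, O x -> O y -> f (x * y) = f x * f y)].

Definition iso_class (O : set K) : set (set K) :=
  [set O' | is_order O' /\ order_iso O O'].

Definition orders_of_type (T : seq nat) : set (set (set K)) :=
  [set C | exists O, [/\ is_order O, has_tower_type O T & C = iso_class O]].

(* [lambda i] and [absdisc] are isomorphism invariants, so it does not matter
   which representative of the class is taken. *)
Definition log_minima (n : nat) (C : set (set K)) : 'rV[R]_n.-1 :=
  let O := xget set0 C in
  \row_i (ln (lambda i.+1 O) / ln (ratr (absdisc O))).

Definition cofinite_in (S : set (set (set K))) : set_system (set (set K)) :=
  [set A | finite_set (S `\` A)].

Lemma cofinite_in_proper S : infinite_set S -> ProperFilter (cofinite_in S).
Proof.
move=> Sinf; split; first by rewrite /cofinite_in /= setD0.
split.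
- by rewrite /cofinite_in /= setDT; exact: finite_set0.
- move=> A B fA fB; have : finite_set (S `\` A `|` S `\` B).
    by rewrite finite_setU.
  by rewrite !setDE -setIUr -setCI.
- by move=> A B AB; apply: sub_finite_set => C [SC nB]; split=> // /AB.
Qed.

(* The orders of K of bounded discriminant are finite in number, so a limit over
   an infinite set of orders is a limit along its cofinite subsets. *)
Definition is_Minkowski_type (n : nat) (S : set (set (set K)))
    (x : 'rV[R]_n.-1) : Prop :=
  infinite_set S /\ log_minima n C @[C --> cofinite_in S] --> x.

Definition Spe (n : nat) (S : set (set (set K))) : set 'rV[R]_n.-1 :=
  [set x : 'rV[R]_n.-1 | exists2 S', S' `<=` S & is_Minkowski_type S' x].

End NumberField.

Arguments Len R T n : clear implicits.
Arguments orders_of_type R K T : clear implicits.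
Arguments Spe R K n S : clear implicits.

(* Main.v *)
(* Let Q = K_0 < ... < K_t = K be the tower of an order of type T, and choose a_s
   with K_s = K_(s-1)(a_s).  In mixed radix, the monomials v_i = prod_s a_s^(i_s)
   form a basis of K with v_i v_j = v_(i+j) when i + j does not overflow; when it
   does, v_i v_j lies in the span of v_0, ..., v_k for a k which is a
   non-overflowing sum of some i' <= i and j' <= j.  Hence, for a point x of the
   Lenstra polytope and e_i = ceil(m x_i) + i, the lattice generated by 1 and the
   d b^(e_i) v_i is an order as soon as d clears the denominators of the structure
   constants.  Inverting the matrix of the embeddings bounds the coordinates of a
   vector by its length, so lambda_i is b^(e_i) up to a constant factor, while the
   discriminant is b^(2 sum e_i) = b^m up to a constant factor; thus the
   logarithms of the minima converge to x as m grows.  The summand i in e_i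
   separates the minima by factors of b, which for b large forces the tower type
   to be T. *)
From HB Require Import structures.
Require Import Defs.
From mathcomp Require Import all_boot all_order all_algebra all_field.
From mathcomp Require Import all_classical all_reals all_analysis.
From mathcomp Require Import complex zify ring lra.

Set Implicit Arguments.
Unset Strict Implicit.
Unset Printing Implicit Defensive.

Import Order.TTheory GRing.Theory Num.Theory.
Import numFieldNormedType.Exports.
Local Open Scope classical_set_scope.
Local Open Scope ring_scope.

(** * Minimal subspaces and subfields; primitive elements *)

Section MinimalSpaces.
Variable K : fieldExtType rat.

(** A space of least dimension containing [A] lies in every other such [V], since intersecting it
    with [V] cannot lower the dimension. Hence the [xget] in [Qspan] is a genuine choice and not its
    default; [Qfield_spec] repeats the argument for subfields. *)
Lemma Qspan_spec (A : set K) : A `<=` [set` Qspan A] /\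
  forall V : {vspace K}, A `<=` [set` V] -> (Qspan A <= V)%VS.
Proof.
rewrite /Qspan; set S := (X in xget _ X); suff : exists U, S U by exact: (@xgetPex _ 0%VS S).
rewrite {}/S /=.
pose P d := `[< exists2 V : {vspace K}, A `<=` [set` V] & \dim V = d >].
have exP : exists d, P d 
  by exists (\dim {:K}); apply/asboolP; exists fullv => // y _; exact: memvf.
case: (ex_minnP exP) => d /asboolP[U AU dU] dmin; exists U; split=> // V AV.
have AUV : A `<=` [set` (U :&: V)%VS].
  by move=> y Ay /=; rewrite memv_cap AU //= AV.
have : (d <= \dim (U :&: V))%N by apply: dmin; apply/asboolP; exists (U :&: V)%VS.
rewrite -dU (geq_leqif (dimv_leqif_sup (capvSl U V))) => UUV.
exact: subv_trans UUV (capvSr _ _).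
Qed.

Lemma Qfield_spec (A : set K) : A `<=` [set` Qfield A] /\
  forall E : {subfield K}, A `<=` [set` E] -> (Qfield A <= E)%VS.
Proof.
rewrite /Qfield; set S := (X in xget _ X); suff : exists U, S U by exact: (@xgetPex _ 1%AS S).
rewrite {}/S /=.
pose P d := `[< exists2 V : {subfield K}, A `<=` [set` V] & \dim V = d >].
have exP : exists d, P d.
  by exists (\dim {:K}); apply/asboolP; exists {:K}%AS => // y _; rewrite /= memvf.
case: (ex_minnP exP) => d /asboolP[U AU dU] dmin; exists U; split=> // V AV.
have AUV : A `<=` [set` (U :&: V)%AS].
  by move=> y Ay /=; rewrite memv_cap AU //= AV.
have : (d <= \dim (U :&: V)%AS)%N by apply: dmin; apply/asboolP; exists (U :&: V)%AS.
rewrite -dU (geq_leqif (dimv_leqif_sup (capvSl U V))) => UUV.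
exact: subv_trans UUV (capvSr _ _).
Qed.

Lemma pchar0_numfield : [pchar K] =i pred0.
Proof. by move=> p; rewrite GRing.pchar_lalg Num.Theory.pchar_num. Qed.

Lemma primitive_element (E F : {subfield K}) : (E <= F)%VS ->
  exists x, F = <<E; x>>%AS.
Proof.
move=> sEF; exists (separable_generator E F); apply/val_inj.
apply: (eq_adjoin_separable_generator _ sEF).
by apply/separableP => y _; apply: pcharf0_separable; exact: pchar0_numfield.
Qed.

End MinimalSpaces.

(** * Complex embeddings and the length function *)

Section Embeddings.
Variables (R : realType) (K : fieldExtType rat).
Implicit Types (x y : K).
Local Notation n := (\dim {:K}).
Local Notation normc := (@Normc.normc R).

Lemma ratr_complexE (a : rat) : ratr a = (ratr a)%:C%C :> R[i].
Proof. exact: (esym (fmorph_rat (real_complex R) a)). Qed.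

Lemma normc_real (a : R) : normc a%:C%C = `|a|.
Proof. by rewrite /Normc.normc /= expr0n addr0 sqrtr_sqr. Qed.

Lemma normc_ge0 (z : R[i]) : 0 <= normc z.
Proof. by case: z => a b; exact: sqrtr_ge0. Qed.

Lemma normc_sum (I : Type) (r : seq I) (F : I -> R[i]) :
  normc (\sum_(i <- r) F i) <= \sum_(i <- r) normc (F i).
Proof.
elim: r => [|i r IH]; first by rewrite !big_nil Normc.normc0.
by rewrite !big_cons; apply: le_trans (le_normcD _ _) _; rewrite lerD2l.
Qed.

(** Every element of [K] is the value at [x] of some polynomial [q], and is sent to the value of [q]
    at [z]. Two choices of [q] differ by a multiple of the minimal polynomial, which vanishes at
    [z], so the map is well defined. *)
Lemma embedding_of_root x : <<1; x>>%VS = {:K}%VS -> forall p : {poly rat},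
  minPoly 1 x = map_poly (in_alg K) p -> forall z : R[i],
  root (map_poly ratr p) z -> exists s : {rmorphism K -> R[i]}, s x = z.
Proof.
move=> xK p Dp z pz.
pose ev (q : {poly rat}) := (map_poly (in_alg K) q).[x].
pose sg (q : {poly rat}) := (map_poly ratr q).[z] : R[i].
have evM q1 q2 : ev (q1 * q2) = ev q1 * ev q2 by rewrite /ev rmorphM hornerM.
have evB q1 q2 : ev (q1 - q2) = ev q1 - ev q2.
  by rewrite /ev rmorphB /= hornerD hornerN.
have sgM q1 q2 : sg (q1 * q2) = sg q1 * sg q2 by rewrite /sg rmorphM hornerM.
have sgB q1 q2 : sg (q1 - q2) = sg q1 - sg q2.
  by rewrite /sg rmorphB /= hornerD hornerN.
have ev_sg q1 q2 : ev q1 = ev q2 -> sg q1 = sg q2.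
  move=> /eqP; rewrite -subr_eq0 -evB => /eqP q0; apply/eqP.
  rewrite -subr_eq0 -sgB; set q := q1 - q2 in q0 *.
  have : minPoly 1 x %| map_poly (in_alg K) q.
    apply: minPoly_dvdp; last exact/rootP.
    by apply/polyOver1P; exists q.
  rewrite Dp dvdp_map => /dvdpP[r ->].
  by rewrite sgM [sg p](rootP pz) mulr0.
have exq y : exists q, ev q = y.
  have /Fadjoin1_polyP[q ->] : y \in <<1; x>>%VS by rewrite xK memvf.
  by exists q.
pose pol y := sval (cid (exq y)).
have polE y : ev (pol y) = y := svalP (cid (exq y)).
pose f y := sg (pol y).
have fM : monoid_morphism f.
  split=> [|y1 y2]; rewrite /f.
    rewrite -[RHS](_ : sg 1 = 1); last by rewrite /sg rmorph1 hornerC.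
    by apply: ev_sg; rewrite polE /ev rmorph1 hornerC.
  by rewrite -sgM; apply: ev_sg; rewrite evM !polE.
have fB : zmod_morphism f.
  by move=> y1 y2; rewrite /f -sgB; apply: ev_sg; rewrite evB !polE.
pose s := HB.pack_for {rmorphism K -> R[i]} f
  (GRing.isZmodMorphism.Build _ _ f fB) (GRing.isMonoidMorphism.Build _ _ f fM).
exists s; rewrite /= /f -[RHS](_ : sg 'X = z); last by rewrite /sg map_polyX hornerX.
by apply: ev_sg; rewrite polE /ev map_polyX hornerX.
Qed.

Lemma rmorph_horner_rat (L : fieldType) (s : {rmorphism K -> L}) (p : {poly rat}) x :
  s (map_poly (in_alg K) p).[x] = (map_poly ratr p).[s x].
Proof.
rewrite -horner_map -map_poly_comp; congr (_.[_]); apply: eq_map_poly => a /=.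
by rewrite rmorphZ_num rmorph1 mulr1.
Qed.

(** In characteristic zero the minimal polynomial of a primitive element is separable, so it has [n]
    distinct complex roots. Each is the image of [x] under an embedding, and every embedding sends
    [x] to a root. *)
Lemma conjugates : exists (x : K) (z : n.-tuple R[i]) (s : 'I_n -> {rmorphism K -> R[i]}),
  [/\ <<1; x>>%VS = {:K}%VS, uniq z, forall i, s i x = tnth z i &
      forall t : {rmorphism K -> R[i]}, t x \in z].
Proof.
have [x xE] := @primitive_element K 1%AS {:K}%AS (sub1v _).
have xK : <<1; x>>%VS = {:K}%VS by rewrite [RHS](congr1 val xE).
have /polyOver1P[p Dp] : minPoly 1 x \is a polyOver 1%VS by exact: minPolyOver.
have p_sep : separable_poly (map_poly (ratr : rat -> R[i]) p).
  rewrite separable_map -(separable_map (in_alg K)) -Dp.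
  by apply: pcharf0_separable; exact: pchar0_numfield.
have p_mon : p \is monic.
  by rewrite -(map_monic (in_alg K)) -Dp; exact: monic_minPoly.
have [r Dr] := closed_field_poly_normal (map_poly (ratr : rat -> R[i]) p).
move: Dr; rewrite (monicP _) ?map_monic // scale1r => Dr.
have size_r : size r = n.
  have := congr1 (fun q => size (q : {poly _})) Dr.
  rewrite size_prod_XsubC size_map_poly -(size_map_poly (in_alg K)) -Dp.
  rewrite size_minPoly adjoin_degreeE dimv1 divn1 => -[<-].
  by congr (\dim _).
have size_rb : size r == n by apply/eqP.
pose z : n.-tuple R[i] := Tuple size_rb.
have zroot i : root (map_poly ratr p) (tnth z i).
  by rewrite Dr root_prod_XsubC mem_tnth.
pose s i := sval (cid (embedding_of_root xK Dp (zroot i))).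
exists x, z, s; split=> //.
- by rewrite -separable_prod_XsubC -Dr.
- by move=> i; exact: (svalP (cid (embedding_of_root xK Dp (zroot i)))).
move=> t; have: root (map_poly ratr p) (t x); last by rewrite Dr root_prod_XsubC.
by rewrite /root -rmorph_horner_rat -Dp minPolyxx rmorph0.
Qed.

(** An embedding is determined by its value at a primitive element, which is one of the entries of
    [z]. Finiteness makes the sum in [len] a genuine sum over all embeddings. *)
Lemma finite_embeddings : finite_set (@embeddings R K).
Proof.
have [x [z [s [xK _ _ zP]]]] := conjugates.
apply: (@sub_finite_set _ _ ((fun w => xget (fun=> 0) [set f : K -> R[i] |
   exists2 t : {rmorphism K -> R[i]}, f = t & t x = w]) @` [set` z])); last first.
  exact/finite_image/finite_seq.
move=> _ [t ->]; exists (t x) => /=; first exact: zP.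
have : [set f : K -> R[i] | exists2 t : {rmorphism K -> R[i]}, f = t & t x = t x] t.
  by exists t.
case: xgetP => [f -> [u -> utx] _|/(_ (t : _ -> _)) nt]; last first.
  by move=> _; case: nt; exists t.
apply/funext => y.
have /Fadjoin1_polyP[q ->] : y \in <<1; x>>%VS by rewrite xK memvf.
by rewrite !rmorph_horner_rat utx.
Qed.

Lemma len_ge0 x : 0 <= len R x.
Proof. exact: sqrtr_ge0. Qed.

Lemma lenZ (a : rat) x : len R (a *: x) = `|ratr a| * len R x.
Proof.
rewrite /len -sqrtr_sqr -sqrtrM ?sqr_ge0 // mulrCA; congr (Num.sqrt (_ * _)).
rewrite (@fsbig_distrr R 0 *%R +%R) /=; last exact: finite_embeddings.
apply: eq_fsbigr => f; rewrite inE => -[s ->].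
by rewrite rmorphZ_num Normc.normcM exprMn ratr_complexE normc_real real_normK ?num_real.
Qed.

Lemma embedding_le_len (s : {rmorphism K -> R[i]}) y :
  normc (s y) <= Num.sqrt n%:R * len R y.
Proof.
have n0 : (0 < n)%N by rewrite adim_gt0.
rewrite /len -sqrtrM ?ler0n // mulrA divff ?pnatr_eq0 -?lt0n // mul1r.
rewrite -[leLHS]ger0_norm ?normc_ge0 // -sqrtr_sqr; apply: ler_wsqrtr.
rewrite (fsbigD1 (s : K -> R[i])) /=; [|exact: finite_embeddings|by exists s].
by rewrite lerDl; apply: fsumr_ge0 => f _; exact: sqr_ge0.
Qed.

Lemma len1_gt0 : 0 < len R (1 : K).
Proof.
have [x [z [s _]]] := conjugates.
have n0 : (0 < n)%N by rewrite adim_gt0.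
have := embedding_le_len (s (Ordinal n0)) 1; rewrite rmorph1 Normc.normc1.
rewrite [_ < _]lt_neqAle len_ge0 andbT eq_sym.
by case: eqP => // ->; rewrite mulr0 ler10.
Qed.

(* Inverting the Vandermonde matrix of the conjugates recovers the coordinates
   on the powers of a primitive element from the values of the embeddings. *)
Lemma coord_le_len (X : n.-tuple K) : exists2 k : R, 0 < k &
  forall y i, `|ratr (coord X i y)| <= k * len R y.
Proof.
have [x [z [s [xK z_uniq sx _]]]] := conjugates.
pose V := Vandermonde n (\row_j tnth z j).
have VU : V \in unitmx.
  rewrite unitmxE unitfE det_Vandermonde; apply/prodf_neq0 => i _.
  apply/prodf_neq0 => j ij; rewrite !mxE subr_eq0 (inj_eq (tuple_uniqP _ z_uniq)).
  by rewrite neq_ltn orbC ij.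
pose W := invmx V.
have powP y : exists a : 'I_n -> rat, y = \sum_j a j *: x ^+ j.
  have := Fadjoin_polyOver 1 x y; have := size_Fadjoin_poly 1 x y.
  have := @Fadjoin_poly_eq _ _ 1%AS x y; rewrite xK memvf => /(_ isT).
  move=> yE sz /polyOver1P[q Dq]; exists (fun j => q`_j).
  rewrite -yE Dq (@horner_coef_wide _ n).
    by apply: eq_bigr => j _; rewrite coef_map /= mulr_algl.
  rewrite -Dq (leq_trans sz) // adjoin_degreeE dimv1 divn1.
  exact: eq_leq (congr1 (fun U : {vspace K} => \dim U) xK).
pose kj j := \sum_k normc (W k j).
have aP y (a : 'I_n -> rat) : y = \sum_j a j *: x ^+ j ->
    forall j, `|ratr (a j)| <= kj j * (Num.sqrt n%:R * len R y).
  move=> ya j.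
  have sy : \row_k s k y = (\row_j ratr (a j)) *m V.
    apply/rowP => k; rewrite !mxE ya rmorph_sum; apply: eq_bigr => i _.
    by rewrite rmorphZ_num rmorphXn /= sx !mxE.
  have := congr1 (mulmx^~ W) sy; rewrite mulmxK // => /rowP/(_ j).
  rewrite !mxE => /esym aj.
  rewrite -normc_real -ratr_complexE aj (le_trans (normc_sum _ _)) //.
  rewrite mulr_suml ler_sum // => k _; rewrite !mxE Normc.normcM mulrC.
  by rewrite ler_wpM2l ?normc_ge0 ?embedding_le_len.
pose c (i j : 'I_n) := coord X i (x ^+ j).
(* Summing over [i] gives one constant for all coordinates; the summand 1 makes it positive. *)
pose k := (\sum_i \sum_j `|ratr (c i j)| * kj j) * Num.sqrt n%:R + 1 : R.
have kj0 j : 0 <= kj j by rewrite sumr_ge0 // => k' _; rewrite normc_ge0.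
have ck0 i j : 0 <= `|ratr (c i j)| * kj j :> R by rewrite mulr_ge0.
have ks0 i : 0 <= \sum_j `|ratr (c i j)| * kj j :> R by rewrite sumr_ge0.
exists k; first by rewrite ltr_wpDl // mulr_ge0 ?sqrtr_ge0 // sumr_ge0.
move=> y i; have [a ya] := powP y.
have -> : coord X i y = \sum_j a j * c i j.
  by rewrite ya linear_sum; apply: eq_bigr => j _; rewrite linearZ.
rewrite rmorph_sum (le_trans (ler_norm_sum _ _ _)) //.
apply: (@le_trans _ _ ((\sum_j `|ratr (c i j)| * kj j) * (Num.sqrt n%:R * len R y))).
  rewrite mulr_suml ler_sum // => j _; rewrite rmorphM normrM mulrC -mulrA.
  by rewrite ler_wpM2l // aP.
rewrite mulrA ler_wpM2r ?len_ge0 // /k ler_wpDr // ler_wpM2r ?sqrtr_ge0 //.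
by rewrite [leRHS](bigD1 i) //= lerDl sumr_ge0.
Qed.

End Embeddings.

(** * Mixed radix digits and overflow *)

Section MixedRadix.
Implicit Types (T : seq nat) (m i j a b k : nat).

Lemma tower_degree_rcons T m : tower_degree (rcons T m) = (tower_degree T * m)%N.
Proof. by rewrite /tower_degree -cats1 big_cat big_seq1. Qed.

Lemma tower_degree_gt0 T : is_tower_type T -> (0 < tower_degree T)%N.
Proof. by move/(radix_weight_gt0 (size T)); rewrite /radix_weight take_size. Qed.

Lemma is_tower_type_rcons T m :
  is_tower_type (rcons T m) -> is_tower_type T /\ (1 < m)%N.
Proof. by rewrite /is_tower_type all_rcons => /andP[]. Qed.

Lemma tower_degree_factor T s : (s < size T)%N -> exists c,
  tower_degree T = (radix_weight T s * (nth 1 T s * c))%N.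
Proof.
move=> sT; exists (\prod_(m <- drop s.+1 T) m)%N.
rewrite /tower_degree -[in LHS](cat_take_drop s.+1 T) big_cat /= mulnA.
by rewrite (take_nth 1%N) // -cats1 big_cat big_seq1.
Qed.

Lemma digit_rcons_lt T m s i a : is_tower_type T -> (s < size T)%N ->
  digit (rcons T m) s (i + tower_degree T * a) = digit T s i.
Proof.
move=> hT sT; have [c ->] := tower_degree_factor sT.
rewrite /digit /radix_weight -cats1 takel_cat 1?ltnW // nth_cat sT.
rewrite -/(radix_weight T s); have w0 := radix_weight_gt0 s hT.
rewrite -mulnA addnC [(radix_weight T s * _)%N]mulnC divnMDl // -mulnA.
by rewrite [(nth _ _ _ * _)%N]mulnC modnMDl.
Qed.

Lemma digit_rcons_size T m i a : (i < tower_degree T)%N -> (a < m)%N ->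
  digit (rcons T m) (size T) (i + tower_degree T * a) = a.
Proof.
move=> iW am; rewrite /digit /radix_weight -cats1 take_size_cat //.
rewrite nth_cat ltnn subnn /= -/(tower_degree T) addnC mulnC divnMDl ?(leq_ltn_trans _ iW) //.
by rewrite divn_small // addn0 modn_small.
Qed.

Lemma no_overflow_rcons T m i j a b : is_tower_type T ->
  (i + j < tower_degree T)%N -> (a + b < m)%N -> no_overflow T i j ->
  no_overflow (rcons T m) (i + tower_degree T * a) (j + tower_degree T * b).
Proof.
move=> hT ijW abm hij s; rewrite size_rcons ltnS addnACA -mulnDr.
rewrite leq_eqVlt => /predU1P[->|sT]; last by rewrite !digit_rcons_lt ?hij.
have iW := leq_ltn_trans (leq_addr j i) ijW.
have jW := leq_ltn_trans (leq_addl i j) ijW.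
have am := leq_ltn_trans (leq_addr b a) abm.
have bm := leq_ltn_trans (leq_addl a b) abm.
by rewrite !digit_rcons_size.
Qed.

Lemma ltn_addM i a W m : (i < W)%N -> (a < m)%N -> (i + W * a < W * m)%N.
Proof.
move=> iW am; apply: (@leq_trans (W * a.+1)); last by rewrite leq_mul2l am orbT.
by rewrite mulnS ltn_add2r.
Qed.

(** All digits of [(tower_degree T).-1] are maximal, so subtracting [j] from it borrows nothing. The
    induction splits off the top digit. *)
Lemma no_overflow_complement T j : is_tower_type T -> (j < tower_degree T)%N ->
  no_overflow T ((tower_degree T).-1 - j) j.
Proof.
elim/last_ind: T j => [|T m IH] j //.
rewrite tower_degree_rcons => /is_tower_type_rcons[hT m1].
set W := tower_degree T => jW; have W0 : (0 < W)%N := tower_degree_gt0 hT.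
have m0 : (0 < m)%N := ltnW m1.
have b_m : (j %/ W < m)%N by rewrite ltn_divLR // mulnC.
have j_W : (j %% W < W)%N by rewrite ltn_mod.
have -> : ((W * m).-1 - j = (W.-1 - j %% W) + W * (m.-1 - j %/ W))%N.
  rewrite {1}(divn_eq j W) mulnBr mulnC; move: (j %% W)%N (j %/ W)%N j_W b_m => c b cW bm.
  have : (W * b <= W * m.-1)%N by rewrite leq_mul2l -ltnS prednK // bm orbT.
  have -> : (m * W = W * m.-1 + W)%N by rewrite mulnC -{1}(prednK m0) mulnS addnC.
  by rewrite [(b * W)%N]mulnC; move: (W * b)%N (W * m.-1)%N => p q; lia.
rewrite [X in no_overflow _ _ X](divn_eq j W) [X in no_overflow _ _ X]addnC.
rewrite [(_ %/ _ * _)%N]mulnC.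
apply: no_overflow_rcons => //; last exact: IH.
- by rewrite subnK ?prednK // -ltnS prednK.
- by rewrite subnK ?prednK // -ltnS prednK.
Qed.

(* [k] is a non-overflowing sum of two indices below [i] and [j]: by
   monotonicity, [x_k <= x_i + x_j] on the Lenstra polytope. *)
Definition dominated T i j k : Prop := exists i' j',
  [/\ (i' <= i)%N, (j' <= j)%N, k = (i' + j')%N, (k < tower_degree T)%N
    & no_overflow T i' j'].

Lemma dominated_rcons T m i j k a b : is_tower_type T -> (a + b < m)%N ->
  dominated T i j k ->
  dominated (rcons T m) (i + tower_degree T * a) (j + tower_degree T * b)
    (k + tower_degree T * (a + b)).
Proof.
move=> hT abm [i' [j' [ii jj -> kW no]]].
exists (i' + tower_degree T * a)%N, (j' + tower_degree T * b)%N.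
rewrite !leq_add2r tower_degree_rcons; split=> //.
- by rewrite mulnDr addnACA.
- exact: ltn_addM.
- exact: no_overflow_rcons.
Qed.

(** When the top digits overflow, a product of basis vectors is only known to lie in the whole
    field, so the largest index must be dominated. It is the non-overflowing sum of the second index
    and its complement, and [m <= a + b] keeps that complement below the first index. *)
Lemma dominated_overflow T m i j a b : is_tower_type (rcons T m) ->
  (i < tower_degree T)%N -> (j < tower_degree T)%N -> (b < m)%N -> (m <= a + b)%N ->
  dominated (rcons T m) (i + tower_degree T * a) (j + tower_degree T * b)
    (tower_degree T * m).-1.
Proof.
move=> hTm iW jW bm mab; have [hT m1] := is_tower_type_rcons hTm.
set W := tower_degree T in iW jW *; have W0 : (0 < W)%N := tower_degree_gt0 hT.
have jlt : (j + W * b < W * m)%N by exact: ltn_addM.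
exists ((W * m).-1 - (j + W * b))%N, (j + W * b)%N; split=> //.
- have : (W * m <= W * (a + b))%N by rewrite leq_mul2l mab orbT.
  by rewrite mulnDr; move: (W * a)%N (W * b)%N (W * m)%N jlt => p q r; lia.
- by rewrite subnK // -ltnS prednK // (leq_ltn_trans _ jlt).
- by rewrite tower_degree_rcons prednK // (leq_ltn_trans _ jlt).
- by have := no_overflow_complement hTm; rewrite tower_degree_rcons; apply.
Qed.

End MixedRadix.

(** * Monomial bases adapted to a tower of fields *)

Section TowerBasis.
Variable K : fieldExtType rat.
Implicit Types (v : nat -> K) (X : seq K) (U : {vspace K}).

Lemma span_mulr X U z y : (forall u, u \in X -> u * z \in U) ->
  y \in <<X>>%VS -> y * z \in U.
Proof.
move=> XU; rewrite -[X]in_tupleE => /coord_span ->.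
rewrite mulr_suml memv_suml // => i _.
by rewrite -scalerAl memvZ // XU // mem_nth.
Qed.

Lemma memv_mkseq v N k : (k < N)%N -> v k \in <<mkseq v N>>%VS.
Proof. by move=> kN; rewrite memv_span // map_f // mem_iota. Qed.

Lemma span_mkseqP v N U : (forall k, (k < N)%N -> v k \in U) ->
  (<<mkseq v N>> <= U)%VS.
Proof.
move=> vU; apply/span_subvP => _ /mapP[k + ->].
by rewrite mem_iota => /= /vU.
Qed.

Lemma pairmap_rcons (A B : Type) (f : A -> A -> B) x s y :
  pairmap f x (rcons s y) = rcons (pairmap f x s) (f (last x s) y).
Proof. by rewrite -cats1 pairmap_cat cats1. Qed.

(** Induction on the height of the tower: if [x] generates the top field over the one below, the new
    vector of index [i + W * a] is [v i * x ^+ a]. The last clause presents each field of the tower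
    as the span of an initial segment, whose next vector generates the next field; the tower type of
    the lattices is read off from it. *)
Lemma tower_basis (Ks : seq {subfield K}) (T := pairmap (fun E F : {subfield K} => \dim_E F) 1%AS Ks)
    (W := tower_degree T) :
  is_tower_type T ->
  path (fun E F : {subfield K} => (E <= F)%VS && (E != F)) 1%AS Ks ->
  exists v : nat -> K,
  [/\ v 0 = 1, (last 1%AS Ks : {vspace K}) = <<mkseq v W>>%VS,
      (forall i j, (i < W)%N -> (j < W)%N -> exists2 k, dominated T i j k
          & v i * v j \in <<mkseq v k.+1>>%VS)
    & (forall s, (s <= size Ks)%N -> exists w : nat,
        [/\ (0 < w <= W)%N, (nth 1%AS (1%AS :: Ks) s : {vspace K}) = <<mkseq v w>>%VS
          & (s < size Ks)%N -> (w < W)%N /\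
            (nth 1%AS (1%AS :: Ks) s.+1 : {vspace K}) = <<nth 1%AS (1%AS :: Ks) s; v w>>%VS])].
Proof.
rewrite {}/W {}/T; elim/last_ind: Ks => [|Ks F IH] /=.
  move=> _ _; exists (fun=> 1); rewrite /tower_degree big_nil /mkseq /= span_seq1.
  split=> //.
    move=> i j; rewrite !ltnS !leqn0 => /eqP-> /eqP->; exists 0%N.
      by exists 0%N, 0%N; rewrite /tower_degree big_nil; split.
    by rewrite mulr1 span_seq1 memv_line.
  by move=> s; rewrite leqn0 => /eqP->; exists 1%N; split=> //=; rewrite span_seq1.
rewrite pairmap_rcons rcons_path.
set T := pairmap _ _ _ in IH *; set E := last _ _ in IH *; set m := (X in rcons T X).
move=> hTm /andP[Ks_path /andP[sEF _]].
have [hT m1] := is_tower_type_rcons hTm.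
have [v [v0 Ev vM vs]] := IH hT Ks_path.
rewrite last_rcons tower_degree_rcons size_rcons; set W := tower_degree T in Ev vM vs *.
have W0 : (0 < W)%N by exact: tower_degree_gt0.
have WWm : (W < W * m)%N by rewrite ltn_Pmulr.
have [x Fx] := primitive_element sEF.
have FEx : (F : {vspace K}) = <<E; x>>%VS by rewrite Fx.
pose v' i := v (i %% W)%N * x ^+ (i %/ W).
have v'E i a : (i < W)%N -> v' (i + W * a)%N = v i * x ^+ a.
  move=> iW; rewrite /v' addnC mulnC modnMDl modn_small // divnMDl //.
  by rewrite divn_small // addn0.
have v'lt i : (i < W)%N -> v' i = v i.
  by move=> iW; rewrite -[i in LHS]addn0 -[X in (i + X)%N](muln0 W) v'E // mulr1.
have mk w : (w <= W)%N -> mkseq v' w = mkseq v w.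
  move=> wW; apply/eq_in_map => i; rewrite mem_iota /= => iw.
  by rewrite v'lt // (leq_trans iw).
have xF : x \in F by rewrite FEx memv_adjoin.
have vE i : (i < W)%N -> v i \in E by move=> iW; rewrite Ev memv_mkseq.
have Fspan : (F : {vspace K}) = <<mkseq v' (W * m)>>%VS.
  apply/eqP; rewrite eqEsubv; apply/andP; split; last first.
    apply: span_mkseqP => k _; rewrite memvM ?rpredX //.
    by rewrite (subvP sEF) // vE // ltn_mod.
  rewrite {1}FEx Fadjoin_eq_sum; apply/subv_sumP => a _.
  apply/subvP => _ /memv_cosetP[y Ey ->].
  have am : (a < m)%N.
    by case: a => a /=; rewrite adjoin_degreeE -FEx.
  have : y \in <<mkseq v W>>%VS by rewrite -Ev.
  apply: span_mulr => _ /mapP[i + ->].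
  by rewrite mem_iota /= => iW; rewrite -v'E // memv_mkseq // ltn_addM.
exists v'; split=> //.
- by rewrite v'lt.
- move=> i j iWm jWm.
  have iW : (i %% W < W)%N by rewrite ltn_mod.
  have jW : (j %% W < W)%N by rewrite ltn_mod.
  have am : (i %/ W < m)%N by rewrite ltn_divLR // mulnC.
  have bm : (j %/ W < m)%N by rewrite ltn_divLR // mulnC.
  rewrite (divn_eq i W) (divn_eq j W); move: iW jW am bm.
  clear iWm jWm; move: (i %% W)%N (i %/ W)%N (j %% W)%N (j %/ W)%N => {}i a {}j b iW jW am bm.
  rewrite ![(_ * W)%N]mulnC ![(W * _ + _)%N]addnC.
  (* If the powers of [x] add up to less than [m], the bound for [v i * v j] is shifted by
     [W * (a + b)]; otherwise the product is only placed in [F], the span of all the vectors. *)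
  have [abm|mab] := ltnP (a + b) m; last first.
    exists (W * m).-1; first exact: dominated_overflow.
    rewrite prednK ?(leq_ltn_trans _ WWm) // -Fspan !v'E //.
    by rewrite !memvM ?rpredX // (subvP sEF) // vE.
  have [k kdom vk] := vM i j iW jW.
  exists (k + W * (a + b))%N; first exact: dominated_rcons.
  have [_ [_ [_ _ _ kW _]]] := kdom.
  rewrite !v'E // mulrACA -exprD; apply: span_mulr vk => _ /mapP[l + ->].
  rewrite mem_iota /= ltnS => lk; rewrite -v'E ?(leq_ltn_trans lk) //.
  by rewrite memv_mkseq // ltnS leq_add2r.
move=> s; rewrite -[1%AS :: rcons _ _]rcons_cons !nth_rcons /=.
rewrite leq_eqVlt ltnS => /predU1P[->|sKs].
  rewrite ltnn eqxx; exists (W * m)%N; rewrite ltnn leqnn andbT.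
  by rewrite (leq_ltn_trans _ WWm).
rewrite sKs; move: sKs; rewrite leq_eqVlt => /predU1P[->|sKs].
  rewrite ltnn eqxx; exists W; rewrite W0 ltnW //; split=> //.
  - by rewrite mk // -Ev /E (last_nth 1%AS).
  (* The first vector outside [E] has index [W] and equals [x] because [v 0 = 1]. *)
  - split=> //; rewrite [v' W](_ : _ = x) ?FEx; last first.
      by rewrite -[W in v' W]add0n -[X in (0 + X)%N]muln1 v'E // v0 mul1r.
    by rewrite /E (last_nth 1%AS).
have [w [/andP[w0 wW] sw]] := vs s (ltnW sKs).
rewrite sKs => /(_ isT)[wltW sw1].
exists w; rewrite w0 (leq_trans wW (ltnW WWm)) mk //; split=> // _.
by rewrite (ltn_trans wltW) // v'lt.
Qed.

End TowerBasis.

(** * The trace form and the discriminant *)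

Section Discriminant.
Variable K : fieldExtType rat.
Local Notation n := (\dim {:K}).
Implicit Types (X b : n.-tuple K) (O : set K).

Lemma trace_is_scalar : scalar (@trace K).
Proof. by move=> a x y; rewrite /trace amull_is_linear passmx.mxof_linear mxtraceD mxtraceZ. Qed.

HB.instance Definition _ := @GRing.isLinear.Build rat K rat *%R (@trace K) trace_is_scalar.

Lemma trace1 : trace (1 : K) = n%:R.
Proof.
by rewrite /trace amull1 passmx.mxof1 ?mxtrace1 // (basis_free (vbasisP _)).
Qed.

Definition trace_form b : 'M[rat]_n := \matrix_(i, j) trace (tnth b i * tnth b j).

(** A kernel vector gives [y] with [trace (y * z) = 0] for all [z]. If [y] were nonzero, [z = y^-1]
    would give trace [n], which is nonzero. *)
Lemma det_trace_form_neq0 X : basis_of {:K} X -> \det (trace_form X) != 0.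
Proof.
move=> Xb; apply/det0P => -[w w0 wM].
pose y := \sum_i w 0 i *: tnth X i.
have ytr z : trace (y * z) = 0.
  rewrite (coord_basis Xb (memvf z)) mulr_sumr linear_sum big1 // => j _.
  rewrite -scalerAr linearZ /= [X in _ * X](_ : _ = 0) ?mulr0 //.
  move/rowP/(_ j): wM; rewrite !mxE => <-.
  rewrite /y mulr_suml linear_sum; apply: eq_bigr => i _.
  by rewrite -scalerAl linearZ /= !mxE (tnth_nth 0 X j).
have y0 : y = 0.
  apply/eqP; apply: contraT => y0; have := ytr y^-1.
  by rewrite divff // trace1 => /eqP; rewrite pnatr_eq0 eqn0Ngt adim_gt0.
case/negP: w0; apply/eqP/rowP => i; rewrite mxE.
have /freeP/(_ (w 0)) := basis_free Xb; apply.
by rewrite -[RHS]y0; apply: eq_bigr => k _; rewrite (tnth_nth 0).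
Qed.

Lemma trace_form_sum b b' (P : 'M[rat]_n) :
  (forall i, tnth b' i = \sum_j P i j *: tnth b j) ->
  trace_form b' = P *m trace_form b *m P^T.
Proof.
move=> b'E; apply/matrixP => i j; rewrite !mxE !b'E mulr_suml linear_sum.
under eq_bigr do rewrite mulr_sumr linear_sum.
rewrite exchange_big; apply: eq_bigr => l _; rewrite !mxE mulr_suml.
apply: eq_bigr => k _; rewrite !mxE -scalerAl -scalerAr !linearZ /=.
by rewrite mulrA mulrAC.
Qed.

Lemma Zbasis_matrix O b b' : is_Zbasis O b -> is_Zbasis O b' ->
  exists P : 'M[int]_n, forall i, tnth b' i = \sum_j (P i j)%:~R *: tnth b j.
Proof.
move=> [_ Ob] [_ Ob'].
have Ob'i i : O (tnth b' i).
  rewrite Ob' /=; exists (fun j => (i == j)%:Z).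
  by rewrite (bigD1 i) //= eqxx mulr1z big1 ?addr0 // => j /negPf; rewrite eq_sym => ->.
have exc i : exists c : 'I_n -> int, tnth b' i = \sum_j tnth b j *~ c j.
  by have := Ob'i i; rewrite {1}Ob.
exists (\matrix_(i, j) sval (cid (exc i)) j) => i.
rewrite [LHS](svalP (cid (exc i))); apply: eq_bigr => j _.
by rewrite mxE scaler_int.
Qed.

(** Two Z-bases are related by integer matrices with product the identity, hence of determinant 1 or
    -1, and the determinant of the trace form changes by its square. So the value does not depend on
    the basis that [xget] picks. *)
Lemma absdiscE O b : is_Zbasis O b -> absdisc O = `|\det (trace_form b)|.
Proof.
move=> Ob; rewrite /absdisc.
set S := (X in xget _ X).
have : S (xget 0 S) by apply: (@xgetPex _ 0 S); exists `|\det (trace_form b)|, b.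
case=> b' [Ob' ->]; rewrite -/(trace_form b').
have [P bP] := Zbasis_matrix Ob Ob'; have [Q bQ] := Zbasis_matrix Ob' Ob.
pose r (M : 'M[int]_n) : 'M[rat]_n := map_mx intr M.
have QP : Q *m P = 1%:M.
  apply/matrixP => i k; apply: (@intr_inj rat).
  rewrite !mxE rmorph_sum rmorph_nat /=; under eq_bigr do rewrite rmorphM /=.
  have [bb _] := Ob.
  apply/eqP; rewrite -subr_eq0; apply/eqP.
  have /freeP/(_ (fun k => (\sum_j (Q i j)%:~R * (P j k)%:~R) - (i == k)%:R)) := basis_free bb.
  apply.
  under eq_bigr do rewrite scalerBl -(tnth_nth 0).
    rewrite big_split /= sumrN [X in _ - X](bigD1 i) //= eqxx scale1r.
    rewrite [X in _ - (_ + X)]big1 ?addr0; last first.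
      by move=> j /negPf; rewrite eq_sym => ->; rewrite scale0r.
    apply/eqP; rewrite subr_eq0 bQ; apply/eqP.
    under [RHS]eq_bigr do rewrite bP scaler_sumr.
    rewrite [RHS]exchange_big; apply: eq_bigr => l _.
    by rewrite scaler_suml; apply: eq_bigr => j _; rewrite scalerA.
have detP : `|\det P| = 1.
  have := congr1 determinant QP; rewrite det_mulmx det1 => /(congr1 absz).
  rewrite abszM => /eqP; rewrite muln_eq1 => /andP[_ /eqP dP].
  by rewrite -abszE dP.
rewrite (@trace_form_sum b b' (r P)); last by move=> i; rewrite bP; apply: eq_bigr => j _; rewrite mxE.
rewrite !det_mulmx det_tr !normrM det_map_mx -intr_norm detP mul1r.
by rewrite mulr1.
Qed.

End Discriminant.

(** * Lattices spanned by integer multiples of a fixed basis *)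

Section DiagonalLattice.
Variable K : fieldExtType rat.
Local Notation n := (\dim {:K}).
Variables (X : n.-tuple K) (u : 'I_n -> nat).
Hypotheses (Xb : basis_of {:K} X) (u_gt0 : forall i, (0 < u i)%N).

(** Coordinatewise membership turns closure under products into integrality of numbers, and a short
    vector into one with small coordinates; the generators come back in [diag_lattice_Zbasis]. *)
Definition diag_lattice : set K :=
  [set y | forall i, coord X i y / (u i)%:R \is a Num.int].

Let u_neq0 i : (u i)%:R != 0 :> rat.
Proof. by rewrite pnatr_eq0 -lt0n. Qed.

Definition diag_basis : n.-tuple K := [tuple (u i)%:R *: tnth X i | i < n].

Lemma diag_lattice_Zbasis : is_Zbasis diag_lattice diag_basis.
Proof.
split.
  rewrite basisEdim size_tuple leqnn andbT.
  apply: (@subv_trans _ _ <<X>>%VS); first by rewrite (span_basis Xb).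
  apply/span_subvP => _ /tnthP[i ->].
  rewrite -[tnth X i]scale1r -(mulVf (u_neq0 i)) -scalerA memvZ // memv_span //.
  by apply/tnthP; exists i; rewrite tnth_mktuple.
apply/seteqP; split=> y /=.
  move=> yO; exists (fun i => sval (cid (intrP (yO i)))).
  rewrite [LHS](coord_basis Xb (memvf y)); apply: eq_bigr => i _.
  have ci := svalP (cid (intrP (yO i))); set c := sval _ in ci *.
  rewrite tnth_mktuple -scaler_int scalerA -ci divfK //.
  by rewrite (tnth_nth 0).
case=> c -> i; rewrite linear_sum /= mulr_suml rpred_sum // => j _.
rewrite tnth_mktuple -scaler_int scalerA linearZ /= (tnth_nth 0).
rewrite (coord_free _ _ (basis_free Xb)); have [->|_] := eqVneq j i.
  by rewrite mulr1 mulfK // intr_int.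
by rewrite mulr0 mul0r rpred0.
Qed.

Lemma absdisc_diag_lattice :
  absdisc diag_lattice = \prod_i (u i)%:R ^+ 2 * `|\det (trace_form X)|.
Proof.
rewrite (absdiscE diag_lattice_Zbasis).
rewrite (@trace_form_sum _ X diag_basis (diag_mx (\row_i (u i)%:R))); last first.
  move=> i; rewrite tnth_mktuple (bigD1 i) //= !mxE eqxx mulr1n big1 ?addr0 // => j.
  by move=> /negPf ji; rewrite !mxE eq_sym ji mulr0n scale0r.
rewrite !det_mulmx det_tr !normrM det_diag mulrAC -expr2 real_normK ?num_real //.
congr (_ * _); rewrite -prodrXl; apply: eq_bigr => i _; by rewrite mxE.
Qed.

Lemma diag_lattice_gen i : diag_lattice ((u i)%:R *: tnth X i).
Proof.
move=> j; rewrite linearZ /= (tnth_nth 0) (coord_free _ _ (basis_free Xb)).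
have [->|_] := eqVneq i j; first by rewrite mulr1 mulfV // int_num1.
by rewrite mulr0 mul0r rpred0.
Qed.

(** The quotients in the second hypothesis are the structure constants of [diag_basis]; bilinearity
    does the rest. *)
Lemma diag_lattice_order : diag_lattice 1 ->
  (forall i j k, (u i)%:R * (u j)%:R * coord X k (tnth X i * tnth X j) / (u k)%:R
     \is a Num.int) ->
  is_order diag_lattice.
Proof.
move=> O1 OM; split=> //.
- by move=> x y xO yO i; rewrite linearB /= mulrBl rpredB.
- move=> x y xO yO k.
  rewrite {1}(coord_basis Xb (memvf x)) {1}(coord_basis Xb (memvf y)).
  rewrite mulr_suml linear_sum mulr_suml rpred_sum // => i _.
  rewrite mulr_sumr linear_sum mulr_suml rpred_sum // => j _.
  rewrite -scalerAl -scalerAr !linearZ /= -!(tnth_nth 0).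
  have xyO := rpredM (rpredM (xO i) (yO j)) (OM i j k).
  apply: (eq_ind _ (fun z : rat => is_true (z \is a Num.int)) xyO); field.
  by rewrite !u_neq0.
- by exists diag_basis; exact: diag_lattice_Zbasis.
Qed.

End DiagonalLattice.

(** * Successive minima are attained *)

Section ShortVectors.
Variables (R : realType) (K : fieldExtType rat).
Local Notation n := (\dim {:K}).
Implicit Types (L : set K) (r : R).

Lemma Qspan_mono (A B : set K) : A `<=` B -> (Qspan A <= Qspan B)%VS.
Proof.
move=> AB; apply: (Qspan_spec A).2 => y /AB; exact: (Qspan_spec B).1.
Qed.

Lemma minimumP (A : set R) : (exists m, A m /\ lbound A m) ->
  A (minimum A) /\ lbound A (minimum A).
Proof. exact: (@xgetPex _ 0 [set m : R | A m /\ lbound A m]). Qed.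

(* The dimension of the span of [short L r] only jumps when [r] is the length
   of a vector of [L], hence the minimum is attained. *)
Lemma lambda_spec L i : (forall r, finite_set (@short R K L r)) ->
  (forall y, L y -> len R y = 0 -> y = 0) ->
  (exists r : R, 0 < r /\ (i.+1 <= \dim (Qspan (short L r)))%N) ->
  let A := [set r : R | 0 < r /\ (i.+1 <= \dim (Qspan (short L r)))%N] in
  A (lambda R i L) /\ lbound A (lambda R i L).
Proof.
move=> Lfin L0 [r0 Ar0] A; apply: minimumP; rewrite -/A.
have attained r : A r -> exists y, [/\ L y, len R y <= r & A (len R y)].
  move=> [r_gt0 dr]; have /finite_seqP[s sE] := Lfin r.
  have sP y : y \in s <-> short L r y by rewrite sE.
  (* The span has positive dimension, so some short vector is nonzero; this makes the length of the
     longest one positive, as [A] demands. *)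
  have [[y [ys y0]]|] := pselect (exists y, y \in s /\ y != 0); last first.
    move=> nex; exfalso; move: dr; rewrite ltnNge; apply/negP/negPn.
    apply: (@leq_trans (\dim (0%VS : {vspace K}))); last by rewrite dimv0.
    apply: dimvS; apply: (Qspan_spec _).2 => y /sP ys /=.
    by rewrite memv0; apply: contraT => y0; case: nex; exists y.
  have /tnthP[j0 _] : y \in in_tuple s by [].
  have [j _ jmax] := arg_maxP (fun j : 'I_(size s) => len R (tnth (in_tuple s) j)) (isT : xpredT j0).
  set z := tnth _ j in jmax; have zs : z \in s by exact: (mem_tnth j (in_tuple s)).
  have zmax x : x \in s -> len R x <= len R z.
    by move=> xs; have /tnthP[k ->] : x \in in_tuple s by []; exact: jmax.
  have [Lz zr] := (sP z).1 zs.
  have yz := zmax y ys.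
  exists z; split=> //; split.
    rewrite (lt_le_trans _ yz) // lt_neqAle len_ge0 andbT eq_sym.
    by apply: contra y0 => /eqP ly; apply/eqP/L0 => //; have [] := (sP y).1 ys.
  apply: leq_trans dr _; apply: dimvS; apply: Qspan_mono => x xr.
  by split; [have [] := xr | apply/zmax/sP].
have [y0 [Ly0 y0r0 Ay0]] := attained r0 Ar0.
have /finite_seqP[s sE] := Lfin r0.
have sP y : y \in s <-> short L r0 y by rewrite sE.
pose P (j : 'I_(size s)) := `[< A (len R (tnth (in_tuple s) j)) >].
have /tnthP[j0 y0E] : y0 \in in_tuple s by exact/sP.
have Pj0 : P j0 by apply/asboolP; rewrite -y0E.
have [j /asboolP Aj jmin] := arg_minP (fun j : 'I_(size s) => len R (tnth (in_tuple s) j)) Pj0.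
exists (len R (tnth (in_tuple s) j)); split=> // r Ar.
have [y [Ly yr Ay]] := attained r Ar.
apply: le_trans yr; have [yr0|/ltW yr0] := leP (len R y) r0.
  have /tnthP[k yE] : y \in in_tuple s by exact/sP.
  by rewrite yE; apply: jmin; apply/asboolP; rewrite -yE.
apply: le_trans yr0; have /sP[] := mem_tnth j (in_tuple s); by [].
Qed.

End ShortVectors.

(** * The scaled orders, their minima and their tower type *)

Lemma common_denominator (I : finType) (f : I -> rat) : exists2 d : nat, (0 < d)%N &
  forall i, d%:R * f i \is a Num.int.
Proof.
exists (\prod_i `|denq (f i)|)%N; first by apply: prodn_gt0 => i; rewrite absz_gt0 denq_neq0.
move=> i; rewrite (bigD1 i) //= natrM mulrAC rpredM ?natr_int //.
have -> : `|denq (f i)|%:R = (denq (f i))%:~R :> rat.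
  by rewrite -[in RHS](gez0_abs (denq_ge0 _)).
by rewrite mulrC -numqE intr_int.
Qed.

Section Construction.
Variables (R : realType) (K : fieldExtType rat) (T : seq nat) (v : nat -> K).
Local Notation n := (\dim {:K}).
Local Notation X := (mktuple (fun i : 'I_n => v i)).
Hypotheses (v0 : v 0 = 1) (nT : n = tower_degree T) (Xb : basis_of {:K} X).
Hypothesis vM : forall i j, (i < n)%N -> (j < n)%N -> exists2 k, dominated T i j k
  & v i * v j \in <<mkseq v k.+1>>%VS.

(** Subadditivity keeps products of scaled basis vectors in the lattice; strict growth separates the
    scales [b ^ e i]. *)
Definition admissible (e : nat -> nat) : Prop :=
  [/\ e 0 = 0, (forall i j, (i < j < n)%N -> (e i < e j)%N) &
      forall i j, (i + j < n)%N -> no_overflow T i j -> (e (i + j) <= e i + e j)%N].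

(* The multiplier of [v i]: it is 1 for [v 0 = 1], so that the lattice contains 1,
   and [d] is meant to clear the denominators of the structure constants. *)
Definition scaling (d b : nat) (e : nat -> nat) (i : 'I_n) : nat :=
  (if i == 0 :> nat then 1 else d * b ^ e i)%N.

Let n_gt0 : (0 < n)%N. Proof. exact: adim_gt0. Qed.
Let ord_0 : 'I_n := Ordinal n_gt0.

Let nthX i : (i < n)%N -> X`_i = v i.
Proof. by move=> i_n; rewrite -(tnth_nth 0 X (Ordinal i_n)) tnth_mktuple. Qed.

Let coordX (i j : 'I_n) : coord X i (v j) = (j == i)%:R.
Proof. by rewrite -nthX // coord_free // (basis_free Xb). Qed.

Lemma coord_mkseq k (i : 'I_n) y : (k <= i)%N -> y \in <<mkseq v k>>%VS -> coord X i y = 0.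
Proof.
move=> ki; rewrite -[mkseq v k]in_tupleE => /coord_span ->.
rewrite linear_sum big1 // => j _; rewrite linearZ /=.
have jk : (j < k)%N by case: j => j /=; rewrite size_mkseq.
rewrite nth_mkseq // (_ : v j = v (Ordinal (ltn_trans (leq_trans jk ki) (ltn_ord i)))) //.
by rewrite coordX -val_eqE /= ltn_eqF ?mulr0 // (leq_trans jk).
Qed.

Lemma mkseq_coord k y : (forall i : 'I_n, (k <= i)%N -> coord X i y = 0) -> y \in <<mkseq v k>>%VS.
Proof.
move=> y0; rewrite (coord_basis Xb (memvf y)) memv_suml // => i _; rewrite nthX //.
have [ki|ik] := leqP k i; first by rewrite y0 // scale0r mem0v.
by rewrite memvZ // memv_mkseq.
Qed.

Lemma dim_mkseq k : (k <= n)%N -> \dim <<mkseq v k>> = k.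
Proof.
move=> kn; have : free (mkseq v k); last by move/eqP; rewrite size_mkseq.
have /catl_free : free (mkseq v k ++ drop k X); last exact.
rewrite (_ : _ ++ _ = X) ?(basis_free Xb) //.
rewrite -[RHS](cat_take_drop k X); congr (_ ++ _).
apply: (@eq_from_nth _ 0); first by rewrite size_mkseq size_take_min size_tuple; apply/esym/minn_idPl.
move=> i; rewrite size_mkseq => ik; rewrite nth_mkseq // nth_take // nthX //.
exact: leq_trans ik kn.
Qed.

Lemma admissible_dominated e i j k : admissible e -> (i < n)%N -> (j < n)%N ->
  dominated T i j k -> (e k <= e i + e j)%N.
Proof.
case=> _ einc eadd i_n j_n [i' [j' [i'i j'j -> kn no]]].
rewrite -nT in kn; apply: leq_trans (eadd i' j' kn no) _.
have emono a c : (a <= c)%N -> (c < n)%N -> (e a <= e c)%N.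
  by rewrite leq_eqVlt => /predU1P[-> //|ac cn]; rewrite ltnW // einc // ac.
by rewrite leq_add // emono.
Qed.

Lemma structure_denominator : exists2 d : nat, (0 < d)%N &
  forall i j k : 'I_n, d%:R * coord X k (v i * v j) \is a Num.int.
Proof.
have [d d0 dP] := common_denominator (fun t : 'I_n * 'I_n * 'I_n => coord X t.2 (v t.1.1 * v t.1.2)).
by exists d => // i j k; exact: (dP (i, j, k)).
Qed.

Section Scaled.
Variables (d b : nat) (e : nat -> nat).
Hypotheses (d_gt0 : (0 < d)%N) (b_gt0 : (0 < b)%N) (e_adm : admissible e).
Hypothesis dP : forall i j k : 'I_n, d%:R * coord X k (v i * v j) \is a Num.int.
Local Notation u := (scaling d b e).
Local Notation L := (diag_lattice X u).

Lemma scaling_gt0 i : (0 < u i)%N.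
Proof. by rewrite /scaling; case: eqP => // _; rewrite muln_gt0 d_gt0 expn_gt0 b_gt0. Qed.

Let e_mono i j : (i <= j)%N -> (j < n)%N -> (e i <= e j)%N.
Proof.
rewrite leq_eqVlt => /predU1P[-> //|ij jn]; have [_ einc _] := e_adm.
by rewrite ltnW // einc // ij.
Qed.

(** A basis vector [v k] occurs in [v i * v j] only for [k] up to a dominated index, so
    [e k <= e i + e j] and the power of [b] divides out. Of the two factors [d], one cancels against
    [u k] and the other clears the denominator of the structure constant. *)
Lemma scaled_order : is_order L.
Proof.
have [e0 einc eadd] := e_adm; have u0 := scaling_gt0.
apply: diag_lattice_order => //.
  have -> : 1 = (u ord_0)%:R *: tnth X ord_0.
    by rewrite /scaling /= scale1r tnth_mktuple v0.
  exact: diag_lattice_gen.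
have un0 i : (u i)%:R != 0 :> rat by rewrite pnatr_eq0 -lt0n.
have OM0 (i j k : 'I_n) : i = ord_0 ->
    (u i)%:R * (u j)%:R * coord X k (tnth X i * tnth X j) / (u k)%:R \is a Num.int.
  move=> ->; rewrite {1}/scaling /= mul1r !tnth_mktuple v0 mul1r coordX.
  have [->|_] := eqVneq j k; first by rewrite mulr1 mulfV // int_num1.
  by rewrite mulr0 mul0r int_num0.
move=> i j k; have [/OM0->//|i0] := eqVneq i ord_0.
have [/OM0|j0] := eqVneq j ord_0.
  by move=> /(_ i k); rewrite [(u j)%:R * _]mulrC [tnth X j * _]mulrC.
have ui : u i = (d * b ^ e i)%N by rewrite /scaling (negPf i0 : (i == 0 :> nat) = false).
have uj : u j = (d * b ^ e j)%N by rewrite /scaling (negPf j0 : (j == 0 :> nat) = false).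
have [c0|c_neq0] := eqVneq (coord X k (tnth X i * tnth X j)) 0.
  by rewrite c0 mulr0 mul0r int_num0.
have dc := dP i j k; rewrite !tnth_mktuple in c_neq0 *.
set c := coord _ _ _ in c_neq0 dc *.
have ek : (e k <= e i + e j)%N.
  have [k' k'dom vij] := vM (ltn_ord i) (ltn_ord j).
  apply: leq_trans (admissible_dominated e_adm _ _ k'dom) => //.
  have [_ [_ [_ _ _ k'n _]]] := k'dom; apply: e_mono; last by rewrite nT.
  by rewrite leqNgt; apply: contra c_neq0 => k'k; rewrite /c (coord_mkseq _ vij).
(* The multiplier of [v 0] is 1, so here there is nothing to divide by. *)
have [k0|k0] := eqVneq k ord_0.
  rewrite k0 [u ord_0]/scaling /= divr1 ui.
  have -> : (d * b ^ e i)%:R * (u j)%:R * c = (b ^ e i)%:R * (u j)%:R * (d%:R * c).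
    by rewrite natrM; ring.
  by rewrite rpredM // rpredM ?natr_int.
have uk : u k = (d * b ^ e k)%N by rewrite /scaling (negPf k0 : (k == 0 :> nat) = false).
have bb : (b ^ e i * b ^ e j = b ^ e k * b ^ (e i + e j - e k))%N by rewrite -!expnD subnKC.
have -> : (u i)%:R * (u j)%:R * c / (u k)%:R = (b ^ (e i + e j - e k))%:R * (d%:R * c).
  rewrite ui uj uk !natrM; have := congr1 (fun m => m%:R : rat) bb; rewrite !natrM => bbR.
  have bk0 : (b ^ e k)%:R != 0 :> rat by rewrite pnatr_eq0 -lt0n expn_gt0 b_gt0.
  have d0 : d%:R != 0 :> rat by rewrite pnatr_eq0 -lt0n.
  apply: (mulfI bk0); rewrite [RHS]mulrA -bbR; field.
  by rewrite bk0 d0.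
by rewrite rpredM ?natr_int.
Qed.

Variables (k B : R).
Hypotheses (k_gt0 : 0 < k) (kP : forall y i, `|ratr (coord X i y)| <= k * len R y).
Hypothesis BP : forall i : 'I_n, d%:R * len R (v i) <= B.
Local Notation short := (@short R K).

Let be_ge1 i : 1 <= (b ^ e i)%:R :> R.
Proof. by rewrite ler1n expn_gt0 b_gt0. Qed.

Let B_gt0 : 0 < B.
Proof.
apply: lt_le_trans (BP ord_0); rewrite /= v0 mulr_gt0 ?ltr0n //.
exact: len1_gt0.
Qed.

(** A nonzero rational multiple of [v j] is enough, because spans and generated fields do not see
    rational factors. *)
Lemma scaled_gen_short (i j : nat) r : (j <= i < n)%N -> B * (b ^ e i)%:R <= r ->
  exists2 q : rat, q != 0 & short L r (q *: v j).
Proof.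
move=> /andP[ji i_n] Br; have j_n := leq_ltn_trans ji i_n.
have uj0 := scaling_gt0 (Ordinal j_n).
exists (u (Ordinal j_n))%:R; first by rewrite pnatr_eq0 -lt0n.
split.
  have -> : v j = tnth X (Ordinal j_n) by rewrite tnth_mktuple.
  exact/diag_lattice_gen/scaling_gt0.
apply: le_trans Br; rewrite lenZ ratr_nat ger0_norm ?ler0n //.
apply: (@le_trans _ _ (d%:R * len R (v j) * (b ^ e i)%:R)); last first.
  by rewrite ler_wpM2r ?ler0n // (BP (Ordinal j_n)).
rewrite mulrAC -natrM ler_wpM2r ?len_ge0 // ler_nat /scaling.
case: eqP => _ /=; first by rewrite muln_gt0 d_gt0 expn_gt0 b_gt0.
by rewrite leq_pmul2l // leq_pexp2l // e_mono.
Qed.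

(** A nonzero coordinate at [j >= i] is a nonzero integer times [u j], hence at least [d * b ^ e i]
    in absolute value, whereas [kP] bounds it by [k * r]. *)
Lemma short_coord0 (i : nat) r y : (0 < i)%N -> k * r < d%:R * (b ^ e i)%:R ->
  short L r y -> forall j : 'I_n, (i <= j)%N -> coord X j y = 0.
Proof.
move=> i0 kr [Ly yr] j ij.
have /intrP[c cE] := Ly j.
have uj : u j = (d * b ^ e j)%N.
  by rewrite /scaling; case: eqP => // j0; rewrite j0 leqNgt i0 in ij.
have yE : coord X j y = c%:~R * (u j)%:R.
  by rewrite -cE divfK // pnatr_eq0 -lt0n scaling_gt0.
apply/eqP; apply: contraT => y0.
have c1 : 1 <= `|c|%:~R :> R.
  rewrite -[1]/(1%:~R) ler_int -gtz0_ge1 normr_gt0.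
  by apply: contra y0 => /eqP c0; rewrite yE c0 mul0r.
have := le_lt_trans (ler_wpM2l (ltW k_gt0) yr) kr; rewrite ltNge; case/negP.
apply: le_trans (kP y j); rewrite yE rmorphM /= normrM ratr_int ratr_nat uj.
rewrite -intr_norm [`|_%:R|]ger0_norm ?ler0n // natrM.
apply: (@le_trans _ _ (d%:R * (b ^ e j)%:R)).
  by rewrite ler_wpM2l ?ler0n // ler_nat leq_pexp2l // e_mono.
by rewrite ler_peMl ?mulr_ge0 ?ler0n.
Qed.

Lemma short_sub (i : nat) r : (0 < i)%N -> k * r < d%:R * (b ^ e i)%:R ->
  short L r `<=` [set` <<mkseq v i>>%VS].
Proof. by move=> i0 kr y yr; apply: mkseq_coord => j; apply: short_coord0 yr _. Qed.

Lemma scaled_short_finite r : finite_set (short L r).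
Proof.
have u0 i : (u i)%:R != 0 :> rat by rewrite pnatr_eq0 -lt0n scaling_gt0.
pose N := Num.Def.archi_bound (k * `|r|).
(* The integer coordinates lie between [-N] and [N]; they are coded as [m - N] with [m] in a finite
   ordinal. *)
pose g (f : {ffun 'I_n -> 'I_N.*2.+1}) : K := \sum_i (((f i)%:R - N%:R) * (u i)%:R) *: v i.
apply: (@sub_finite_set _ _ (g @` setT)); last exact/finite_image/finite_finset.
move=> y [Ly yr].
have cbound i : exists m : 'I_N.*2.+1, coord X i y / (u i)%:R = m%:R - N%:R.
  have /intrP[c cE] := Ly i.
  have cN : (`|c| <= N)%N.
    rewrite -(ler_nat R); apply: ltW; apply: le_lt_trans (archi_boundP _); last first.
      by rewrite mulr_ge0 // ltW.
    apply: (@le_trans _ _ (k * len R y)); last first.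
      by apply: ler_wpM2l; [exact: ltW | exact: le_trans yr (ler_norm r)].
    apply: le_trans (kP y i); have -> : coord X i y = c%:~R * (u i)%:R by rewrite -cE divfK.
    rewrite rmorphM /= normrM ratr_int ratr_nat -intr_norm.
    have -> : `|c|%N%:R = `|c|%:~R :> R by rewrite -abszE.
    by rewrite [`|_%:R|]ger0_norm ?ler0n // ler_peMr ?ler1n ?scaling_gt0 // ler0z.
  have mN : (`|(c + N%:Z)%R| < N.*2.+1)%N by clear -cN; lia.
  exists (Ordinal mN); rewrite cE /=.
  have cN0 : 0 <= c + N%:Z by clear -cN; lia.
  have -> : `|(c + N%:Z)%R|%N%:R = (c + N%:Z)%:~R :> rat by rewrite -[in RHS](gez0_abs cN0).
  by rewrite rmorphD /= addrK.
exists [ffun i => sval (cid (cbound i))] => //.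
rewrite [RHS](coord_basis Xb (memvf y)); apply: eq_bigr => i _; rewrite ffunE.
by rewrite -(svalP (cid (cbound i))) divfK // nthX.
Qed.

(** At radius [B * b ^ e i] multiples of [v 0], ..., [v i] are present, which gives [i + 1]
    dimensions. Below [d * b ^ e i / k] all short vectors lie in the span of the first [i] basis
    vectors. *)
Lemma scaled_lambda i : (0 < i < n)%N ->
  d%:R * (b ^ e i)%:R <= k * lambda R i L /\ lambda R i L <= B * (b ^ e i)%:R.
Proof.
move=> /andP[i0 i_n].
have AB : 0 < B * (b ^ e i)%:R /\ (i.+1 <= \dim (Qspan (short L (B * (b ^ e i)%:R))))%N.
  split; first by rewrite mulr_gt0 // (lt_le_trans _ (be_ge1 i)).
  rewrite -(dim_mkseq i_n); apply: dimvS; apply: span_mkseqP => j; rewrite ltnS => ji.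
  have [|q q0 qs] := @scaled_gen_short i j _ _ (lexx _); first by rewrite ji.
  rewrite -[v j]scale1r -(mulVf q0) -scalerA memvZ //.
  exact: (Qspan_spec _).1.
have L0 y : L y -> len R y = 0 -> y = 0.
  move=> _ y0; rewrite (coord_basis Xb (memvf y)) big1 // => j _.
  have := kP y j; rewrite y0 mulr0 normr_le0 fmorph_eq0 => /eqP ->.
  by rewrite scale0r.
have [[l0 ldim] lmin] := lambda_spec scaled_short_finite L0 (ex_intro _ _ AB).
split; last exact: lmin.
rewrite leNgt; apply/negP => /(short_sub i0) /(Qspan_spec _).2 /dimvS.
by rewrite (dim_mkseq (ltnW i_n)) leqNgt ldim.
Qed.

Lemma scaled_absdisc :
  absdisc L = (\prod_(i < n) (u i)%:R) ^+ 2 * `|\det (trace_form X)|.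
Proof.
rewrite absdisc_diag_lattice -?prodrXl //; exact: scaling_gt0.
Qed.

(* This makes the scales [b ^ e i] so far apart that the vectors shorter than a
   multiple of [b ^ e w] span [v 0, ..., v (w - 1)], up to one dimension. *)
Hypothesis b_big : k * B < d%:R * b%:R.

(** Each field of the tower is generated at the radius where its last basis vector has appeared.
    Conversely, at any radius the generated field is the smallest field of the tower containing the
    short vectors: it contains the previous field together with the basis vector [v w] that
    generates the next one. *)
Lemma scaled_tower_type (Ks : seq {subfield K}) :
  path (fun E F : {subfield K} => (E <= F)%VS && (E != F)) 1%AS Ks ->
  last 1%AS Ks = {:K}%AS ->
  T = pairmap (fun E F : {subfield K} => \dim_E F) 1%AS Ks ->
  (forall s, (s <= size Ks)%N -> exists w : nat,
     [/\ (0 < w <= n)%N, (nth 1%AS (1%AS :: Ks) s : {vspace K}) = <<mkseq v w>>%VS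
       & (s < size Ks)%N -> (w < n)%N /\
         (nth 1%AS (1%AS :: Ks) s.+1 : {vspace K}) =
           <<nth 1%AS (1%AS :: Ks) s; v w>>%VS]) ->
  has_tower_type R L T.
Proof.
move=> Ks_path Ks_last TE Ks_span; exists Ks; split=> //.
have [e0 einc _] := e_adm.
have gap i j : (i < j < n)%N -> k * (B * (b ^ e i)%:R) < d%:R * (b ^ e j)%:R.
  move=> ij; rewrite mulrA; apply: (@lt_le_trans _ _ (d%:R * b%:R * (b ^ e i)%:R)).
    by rewrite ltr_pM2r // (lt_le_trans _ (be_ge1 i)).
  by rewrite -mulrA -natrM -expnS ler_wpM2l ?ler0n // ler_nat leq_pexp2l // einc.
have ksub w r : (0 < w <= n)%N -> ((w < n)%N -> k * r < d%:R * (b ^ e w)%:R) ->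
    short L r `<=` [set` <<mkseq v w>>%VS].
  move=> /andP[w0]; rewrite leq_eqVlt => /predU1P[-> _|wn /(_ wn)/short_sub]; last exact.
  by move=> y _; apply: mkseq_coord => j; rewrite leqNgt ltn_ord.
have genK w r : (0 < w <= n)%N -> B * (b ^ e w.-1)%:R <= r ->
    (<<mkseq v w>> <= Qfield (short L r))%VS.
  move=> /andP[w0 wn] Br; apply: span_mkseqP => j jw.
  have [|q q0 qs] := @scaled_gen_short w.-1 j r _ Br.
    by rewrite -[(j <= _)%N]ltnS prednK // jw.
  rewrite -[v j]scale1r -(mulVf q0) -scalerA memvZ //.
  exact: (Qfield_spec _).1.
apply/seteqP; split=> F /=.
  move=> FKs; have := FKs; rewrite -index_mem; set s := index F _ => s_lt.
  have FE : F = nth 1%AS (1%AS :: Ks) s by rewrite nth_index.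
  have [w [wn sw _]] := Ks_span s s_lt.
  (* This radius admits multiples of [v 0], ..., [v w.-1], and by [gap] still excludes every vector
     outside their span. *)
  exists (B * (b ^ e w.-1)%:R); first by rewrite mulr_gt0 // (lt_le_trans _ (be_ge1 _)).
  apply/val_inj/eqP; rewrite eqEsubv /= FE sw (genK _ _ wn) //=.
  rewrite -sw; apply: (Qfield_spec _).2; rewrite sw; apply: ksub => // wn'.
  by apply: gap; rewrite wn' prednK ?leqnn //; case/andP: wn.
case=> r r0 ->.
pose P s := (s <= size Ks)%N && `[< short L r `<=` [set` nth 1%AS (1%AS :: Ks) s] >].
have exP : exists s, P s.
  exists (size Ks); rewrite /P leqnn; apply/asboolP => y _ /=.
  by rewrite nth_last /= Ks_last memvf.
case: (ex_minnP exP) => s /andP[s_le /asboolP sub_s] smin.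
suff -> : Qfield (short L r) = nth 1%AS (1%AS :: Ks) s by rewrite mem_nth.
apply/val_inj/eqP; rewrite eqEsubv /= (Qfield_spec _).2 //=.
case: s => [|s] in s_le sub_s smin *; first exact: sub1v.
have [w [/andP[w0 wn] sw /(_ s_le)[wltn sw1]]] := Ks_span s (ltnW s_le).
have nsub : ~ short L r `<=` [set` <<mkseq v w>>%VS].
  rewrite -sw => sub; have := smin s; rewrite /P (ltnW s_le) ltnn.
  by move=> H; have // := H (introT (asboolP _) sub).
have rw : d%:R * (b ^ e w)%:R <= k * r.
  by rewrite leNgt; apply/negP => /(short_sub w0).
have Br (j : nat) : k * (B * (b ^ e j)%:R) <= k * r -> B * (b ^ e j)%:R <= r.
  by rewrite ler_pM2l.
have Ew : (<<mkseq v w>> <= Qfield (short L r))%VS.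
  apply: genK; rewrite ?w0 //; apply/Br/(le_trans _ rw)/ltW/gap.
  by rewrite prednK ?leqnn.
suff vw : v w \in Qfield (short L r) by rewrite sw1; apply/FadjoinP; rewrite sw.
(* If the short vectors stay in the span of [v 0], ..., [v w], one outside the smaller span yields
   [v w] after subtracting its part in [Ew]. Otherwise [r] has reached the scale of [v w.+1], where
   a multiple of [v w] is already short. *)
have [sub1|nsub1] := pselect (short L r `<=` [set` <<mkseq v w.+1>>%VS]).
  have [y yr yw] : exists2 y, short L r y & y \notin <<mkseq v w>>%VS.
    apply: contrapT => nex; apply: nsub => y yr /=.
    by apply: contraT => yw; case: nex; exists y.
  have := sub1 y yr; rewrite /= /mkseq -addn1 iotaD map_cat span_cat /= add0n span_seq1.
  case/memv_addP=> y1 y1w [_ /vlineP[q ->] yE].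
  have q0 : q != 0 by apply: contra yw => /eqP q0; rewrite yE q0 scale0r addr0.
  rewrite -[v w]scale1r -(mulVf q0) -scalerA memvZ //.
  rewrite -[q *: _](addKr y1) -yE rpredD //; last exact: (Qfield_spec _).1.
  by rewrite rpredN (subvP Ew).
have w1n : (w.+1 < n)%N.
  rewrite ltn_neqAle wltn andbT; apply/eqP => w1n; apply: nsub1.
  by move=> y _; apply: mkseq_coord => j; rewrite w1n leqNgt ltn_ord.
have rw1 : d%:R * (b ^ e w.+1)%:R <= k * r.
  by rewrite leNgt; apply/negP => /(short_sub (ltn0Sn w)).
have [| |q q0 qs] := @scaled_gen_short w w r.
- by rewrite leqnn.
- by apply/Br/(le_trans _ rw1)/ltW/gap; rewrite leqnn.
rewrite -[v w]scale1r -(mulVf q0) -scalerA memvZ //.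
exact: (Qfield_spec _).1.
Qed.

End Scaled.
End Construction.

(** * Invariance of minima and discriminant under isomorphism *)

Section Isomorphisms.
Variables (R : realType) (K : fieldExtType rat).
Local Notation n := (\dim {:K}).
Implicit Types (O : set K) (g : {rmorphism K -> K}).

(** An isomorphism of orders is additive, hence determined by its values on a Z-basis, which is also
    a basis of [K] over the rationals. Its linear extension [h] is multiplicative by bilinearity. *)
Lemma order_iso_extends O O' : is_order O -> order_iso O O' ->
  exists g, O' = g @` O.
Proof.
move=> [one OB OM [b [bb Ob]]] [f [[fO _ fsurj] f1 fD fM]].
have O0 : O 0 by rewrite -(subrr 1); exact: OB.
have ON x : O x -> O (- x) by rewrite -[- x]add0r; exact: OB.
have OD x y : O x -> O y -> O (x + y).
  by move=> Ox Oy; rewrite -[y]opprK; apply/OB/ON.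
have f0 : f 0 = 0 by apply: (addIr (f 0)); rewrite -fD // !add0r.
have fN x : O x -> f (- x) = - f x.
  move=> Ox; apply/eqP; rewrite -subr_eq0 opprK -fD ?addNr ?f0 //; exact: ON.
have OMn x m : O x -> O (x *+ m) /\ f (x *+ m) = f x *+ m.
  move=> Ox; elim: m => [|m [sxm fxm]]; first by rewrite !mulr0n.
  by rewrite !mulrS fD // fxm; split=> //; exact: OD.
have OMz x (c : int) : O x -> O (x *~ c) /\ f (x *~ c) = f x *~ c.
  move=> Ox; case: c => m; first by rewrite -!pmulrn; exact: OMn.
  have [sxm fxm] := OMn x m.+1 Ox.
  by rewrite NegzE !mulrNz -!pmulrn fN // fxm; split=> //; exact: ON.
have Osum (F : 'I_n -> K) : (forall i, O (F i)) ->
    O (\sum_i F i) /\ f (\sum_i F i) = \sum_i f (F i).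
  move=> OF; elim/big_ind2: _ => //= x1 y1 x2 y2 [sx1 fx1] [sx2 fx2].
  by rewrite fD // fx1 fx2; split=> //; exact: OD.
have Obi i : O (tnth b i).
  rewrite Ob /=; exists (fun j => (i == j)%:Z).
  by rewrite (bigD1 i) //= eqxx mulr1z big1 ?addr0 // => j /negPf; rewrite eq_sym => ->.
pose h y := \sum_i coord b i y *: f (tnth b i).
have hf y : O y -> h y = f y.
  rewrite {1}Ob => -[c ->].
  have OF i : O (tnth b i *~ c i) by have [] := OMz _ (c i) (Obi i).
  rewrite (Osum _ OF).2; apply: eq_bigr => i _; rewrite (OMz _ _ (Obi i)).2.
  rewrite linear_sum (bigD1 i) //= big1 ?addr0 => [|j /negPf ji].
    by rewrite -scaler_int linearZ /= (tnth_nth 0) coord_free ?(basis_free bb) // eqxx mulr1 scaler_int.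
  by rewrite -scaler_int linearZ /= (tnth_nth 0) coord_free ?(basis_free bb) // ji mulr0.
have hlin : linear h.
  move=> a x y; rewrite /h scaler_sumr -big_split; apply: eq_bigr => i _ /=.
  by rewrite linearP /= scalerDl scalerA.
pose hL := HB.pack_for {linear K -> K} h (GRing.isLinear.Build rat K K *:%R h hlin).
have hM x y : h (x * y) = h x * h y.
  rewrite {1}(coord_basis bb (memvf x)) {1}(coord_basis bb (memvf y)).
  rewrite -[h]/(hL : K -> K) mulr_suml linear_sum [hL x]/(h x) /h mulr_suml.
  apply: eq_bigr => i _; rewrite !mulr_sumr linear_sum; apply: eq_bigr => j _.
  rewrite -scalerAl -scalerAr !linearZ -scalerAl -scalerAr -!(tnth_nth 0) /=.
  by rewrite hf ?fM //; exact: OM.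
have h1 : h 1 = 1 by rewrite hf.
have hB : zmod_morphism h by move=> x y; exact: (linearB hL).
pose g := HB.pack_for {rmorphism K -> K} h (GRing.isZmodMorphism.Build _ _ h hB)
  (GRing.isMonoidMorphism.Build _ _ h (h1, hM)).
exists g; apply/seteqP; split=> y /=.
  by move=> /fsurj[x Ox <-]; exists x => //; exact: hf.
by move=> [x Ox <-]; rewrite /= hf //; exact: fO.
Qed.

Lemma endomorphism_lfun g : exists G : 'End(K), forall x, G x = g x.
Proof.
have glin : linear g by move=> a x y; rewrite rmorphD fmorph_numZ.
pose gL := HB.pack_for {linear K -> K} (g : K -> K) (GRing.isLinear.Build rat K K *:%R g glin).
by exists (linfun gL) => x; rewrite lfunE.
Qed.

Lemma field_endomorphism_inv g : exists h : {rmorphism K -> K}, cancel g h /\ cancel h g.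
Proof.
have [G GE] := endomorphism_lfun g.
have gker : lker G == 0%VS by apply/lker0P => x y; rewrite !GE; exact: fmorph_inj.
have gsurj y : exists x, g x = y.
  have : y \in limg G.
    suff -> : limg G = fullv by exact: memvf.
    by apply/eqP; rewrite eqEdim subvf limg_dim_eq //= (eqP gker) capv0.
  by move=> /memv_imgP[x _ ->]; exists x; rewrite GE.
pose h y := sval (cid (gsurj y)).
have hK : cancel h g by move=> y; exact: svalP (cid (gsurj y)).
have gK : cancel g h by move=> x; apply: (fmorph_inj g); rewrite hK.
pose h' := HB.pack_for {rmorphism K -> K} h
  (GRing.isZmodMorphism.Build _ _ h (can2_zmod_morphism gK hK))
  (GRing.isMonoidMorphism.Build _ _ h (can2_monoid_morphism gK hK)).
by exists h'.
Qed.

(** An endomorphism of [K] is invertible, so composing with it permutes the embeddings. *)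
Lemma len_endomorphism g x : len R (g x) = len R x.
Proof.
have [h [gK hK]] := field_endomorphism_inv g.
rewrite /len; congr (Num.sqrt (_ * _)); apply/esym.
rewrite (reindex_fsbig (fun f : K -> R[i] => f \o g) (@embeddings R K)) //; split.
- by move=> _ [s ->]; exists (s \o g).
- move=> f1 f2 _ _ f12; apply/funext => y.
  by have := congr1 (fun f => f (h y)) f12; rewrite /= hK.
- move=> _ [s ->]; exists (s \o h : K -> R[i]); first by exists (s \o h).
  by apply/funext => y /=; rewrite gK.
Qed.

Lemma dim_Qspan_image g (A : set K) : (\dim (Qspan (g @` A)) <= \dim (Qspan A))%N.
Proof.
have [G GE] := endomorphism_lfun g.
apply: (@leq_trans (\dim (G @: Qspan A))); last first.
  by rewrite -(limg_ker_dim G (Qspan A)) leq_addl.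
apply: dimvS; apply: (Qspan_spec _).2 => _ [x Ax <-] /=.
by apply/memv_imgP; exists x; [exact: (Qspan_spec A).1 | rewrite GE].
Qed.

Lemma lambda_endomorphism g i O : lambda R i (g @` O) = lambda R i O.
Proof.
have [h [gK hK]] := field_endomorphism_inv g.
have sE r : @short R K (g @` O) r = g @` short O r.
  apply/seteqP; split=> [_ [[x Ox <-] xr]|_ [x [Ox xr] <-]].
    by exists x => //; split=> //; rewrite -(len_endomorphism g).
  by split; [exists x | rewrite len_endomorphism].
have dE r : \dim (Qspan (@short R K (g @` O) r)) = \dim (Qspan (@short R K O r)).
  rewrite sE; apply/eqP; rewrite eqn_leq dim_Qspan_image /=.
  apply: leq_trans (dim_Qspan_image h _); rewrite image_comp.
  suff -> : (h \o g) @` short O r = short O r by [].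
  by under eq_imagel do rewrite /= gK; rewrite image_id.
by rewrite /lambda; congr minimum; apply/seteqP; split=> r /=; rewrite dE.
Qed.

(** Multiplication by [g x] is the conjugate by [g] of multiplication by [x]. *)
Lemma trace_endomorphism g x : trace (g x) = trace x.
Proof.
have [h [gK hK]] := field_endomorphism_inv g.
have [G GE] := endomorphism_lfun g; have [H HE] := endomorphism_lfun h.
have eb : basis_of {:K} (vbasis {:K}) := vbasisP _.
have gxE : amull (g x) = (G \o (amull x \o H))%VF.
  by apply/lfunP => y; rewrite !comp_lfunE GE HE !lfunE /= rmorphM hK.
have HG : (H \o G)%VF = \1%VF by apply/lfunP => y; rewrite comp_lfunE GE HE lfunE /= gK.
rewrite /trace gxE !(passmx.mxof_comp _ _ eb) mxtrace_mulC mulmxA.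
by rewrite -(passmx.mxof_comp _ _ eb) HG passmx.mxof1 ?mul1mx // (basis_free eb).
Qed.

Lemma absdisc_endomorphism g O : is_order O -> absdisc (g @` O) = absdisc O.
Proof.
move=> [_ _ _ [b Ob]]; pose gb : n.-tuple K := [tuple g (tnth b i) | i < n].
have [h [gK hK]] := field_endomorphism_inv g.
have gsum (c : 'I_n -> rat) : g (\sum_i c i *: tnth b i) = \sum_i c i *: tnth gb i.
  by rewrite rmorph_sum; apply: eq_bigr => i _; rewrite fmorph_numZ tnth_mktuple.
have [bb bE] := Ob.
have Ogb : is_Zbasis (g @` O) gb.
  split.
    rewrite basisEdim size_tuple leqnn andbT; apply/subvP => y _.
    rewrite -[y]hK (coord_basis bb (memvf (h y))).
    under eq_bigr do rewrite -(tnth_nth 0); rewrite gsum memv_suml // => i _.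
    by rewrite memvZ // memv_span // mem_tnth.
  have intE (t : n.-tuple K) (c : 'I_n -> int) :
      \sum_i tnth t i *~ c i = \sum_i (c i)%:~R *: tnth t i.
    by apply: eq_bigr => i _; rewrite scaler_int.
  apply/seteqP; split=> [_ [x + <-]|_ [c ->]].
    by rewrite bE => -[c ->]; exists c; rewrite !intE gsum.
  exists (\sum_i tnth b i *~ c i); first by rewrite bE; exists c.
  by rewrite !intE gsum.
rewrite (absdiscE Ogb) (absdiscE Ob); congr (`|\det _|).
by apply/matrixP => i j; rewrite !mxE !tnth_mktuple -rmorphM trace_endomorphism.
Qed.

Lemma iso_class_invariants O O' : is_order O -> iso_class O O' ->
  (forall i, lambda R i O' = lambda R i O) /\ absdisc O' = absdisc O.
Proof.
move=> Oord [_ /(order_iso_extends Oord)[g ->]]; split=> [i|].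
  exact: lambda_endomorphism.
exact: absdisc_endomorphism.
Qed.

Lemma iso_class_refl O : is_order O -> iso_class O O.
Proof. by move=> Oord; split=> //; exists id; split=> //; split=> // y; exists y. Qed.

Lemma log_minima_iso_class m O : is_order O -> log_minima R m (iso_class O) =
  \row_i (ln (lambda R i.+1 O) / ln (ratr (absdisc O))).
Proof.
move=> Oord; have : iso_class O (xget set0 (iso_class O)).
  by apply: xgetPex; exists O; exact: iso_class_refl.
case/(iso_class_invariants Oord) => lE dE.
by apply/rowP => i; rewrite !mxE lE dE.
Qed.

End Isomorphisms.

(** * From logarithmic estimates to limits *)

Section Asymptotics.
Variable R : realType.

(* If [ln lambda = m y L + O(1)] and [ln Delta = m L + O(1)], then the
   logarithm of [lambda] in base [Delta] tends to [y]. *)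
Lemma ratio_approx (L c eps A : R) : 0 < L -> 0 < eps -> exists M : nat,
  forall m : nat, (M <= m)%N -> forall a y D : R, 0 <= y <= 1 ->
    `|a - m%:R * y * L| <= c -> `|D - m%:R * L| <= c -> A < D /\ `|y - a / D| < eps.
Proof.
(* Once [m * L] exceeds [Z], [D] exceeds both [A] and [(c + c) / eps]; the latter makes the error
   [(c + c) / D] smaller than [eps]. *)
move=> L0 eps0; pose Z := `|c| + `|A| + (c + c) / eps + 1.
have c_le := ler_norm c; have A_le := ler_norm A.
pose M := Num.Def.archi_bound (`|Z| / L).
have ZM : Z < M%:R * L.
  rewrite -ltr_pdivrMr //; apply: le_lt_trans (archi_boundP _); last first.
    by rewrite divr_ge0 // ltW.
  by rewrite ler_pM2r ?invr_gt0 // ler_norm.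
exists M => m Mm a y D /andP[y0 y1] ay Dm.
have c0 : 0 <= c := le_trans (normr_ge0 _) ay.
have q0 : 0 <= (c + c) / eps by rewrite divr_ge0 ?addr_ge0 // ltW.
have mL : M%:R * L <= m%:R * L by rewrite ler_pM2r // ler_nat.
have D_gt : `|A| + (c + c) / eps + 1 <= D.
  move: Dm; rewrite ler_norml => /andP[Dm _]; rewrite /Z ger0_norm // in ZM; lra.
have D0 : 0 < D by apply: lt_le_trans D_gt; rewrite ltr_wpDl // addr_ge0.
split; first by apply: le_lt_trans A_le _; apply: lt_le_trans D_gt; lra.
have -> : y - a / D = (y * D - a) / D by field; exact: lt0r_neq0.
rewrite normrM normfV (gtr0_norm D0) ltr_pdivrMr //.
have yDa : `|y * D - a| <= c + c.
  have -> : y * D - a = y * (D - m%:R * L) - (a - m%:R * y * L) by ring.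
  apply: le_trans (ler_normB _ _) _; rewrite lerD // normrM (ger0_norm y0).
  by rewrite -[c]mul1r ler_pM.
apply: le_lt_trans yDa _; rewrite mulrC -ltr_pdivrMr //.
by apply: lt_le_trans D_gt; have := normr_ge0 A; lra.
Qed.

(** Unbounded discriminants force the range of [C] to be infinite. Classes outside a given
    neighbourhood of [x] are among the [C m] with [m < M], so convergence of the sequence gives
    convergence along the cofinite filter. *)
Lemma Spe_seq (K : fieldExtType rat) (n : nat) (S : set (set (set K)))
    (C : nat -> set (set K)) (x : 'rV[R]_n.-1) :
  (forall m, S (C m)) ->
  (forall A : R, exists m, A < ln (ratr (absdisc (xget set0 (C m))))) ->
  (forall eps : R, 0 < eps -> exists M, forall m, (M <= m)%N ->
     forall i, `|x ord0 i - log_minima R n (C m) ord0 i| < eps) ->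
  Spe R K n S x.
Proof.
move=> SC Cinf Ccvg; exists (range C); first by move=> _ [m _ <-].
split.
  move=> Cfin; pose D (c : set (set K)) : R := ln (ratr (absdisc (xget set0 c))).
  have /finite_seqP[s sE] := finite_image D Cfin.
  have [m] := Cinf (\sum_(y <- s) `|y|); rewrite ltNge; case/negP.
  have Dms : D (C m) \in s.
    have : [set` s] (D (C m)) by rewrite -sE; exists (C m) => //; exists m.
    by [].
  apply: le_trans (ler_norm _) _; rewrite (big_rem _ Dms) /= lerDl.
  exact: sumr_ge0.
move=> A /nbhs_ballP[eps /= eps0 xA]; have [M CM] := Ccvg eps eps0.
apply: (@sub_finite_set _ _ (C @` `I_M)); last exact/finite_image/finite_II.
move=> _ [[m _ <-] nA]; exists m => //=; rewrite ltnNge; apply/negP => Mm.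
apply: nA; apply: xA; split=> // i j; rewrite ord1.
exact: CM.
Qed.

End Asymptotics.

(** * Integer exponents from a point of the Lenstra polytope *)

Section LenstraExponents.
Variables (R : realType) (T : seq nat) (n : nat) (x : 'rV[R]_n.-1).
Hypothesis xLen : Len R T n x.

(* [coordinate i] is x_i, with x_0 = 0. *)
Definition coordinate (i : nat) : R :=
  if i is j.+1 then oapp (x ord0) 0 (insub j) else 0.

Lemma coordinateS (j : 'I_n.-1) : coordinate j.+1 = x ord0 j.
Proof. by rewrite /coordinate valK. Qed.

Lemma coordinate_ge0 i : 0 <= coordinate i.
Proof.
case: i => //= i; case: insubP => //= j _ _.
by have [_ x0 _ _] := xLen.
Qed.

Let lt_pred i : (i.+1 < n)%N -> (i < n.-1)%N.
Proof. by case: n. Qed.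

Lemma coordinate_mono i j : (i <= j < n)%N -> coordinate i <= coordinate j.
Proof.
move=> /andP[ij jn]; case: i ij => [|i] ij; first exact: coordinate_ge0.
case: j ij jn => // j ij jn; have jn' := lt_pred jn.
have in' : (i < n.-1)%N by apply: leq_ltn_trans jn'; exact: ij.
rewrite (coordinateS (Ordinal in')) (coordinateS (Ordinal jn')).
by have [_ _ + _] := xLen; apply.
Qed.

Lemma coordinateD i j : (i + j < n)%N -> no_overflow T i j ->
  coordinate (i + j) <= coordinate i + coordinate j.
Proof.
case: i => [|i]; first by rewrite add0r.
case: j => [|j]; first by rewrite addn0 addr0.
move=> ijn no; have ijn' : (i + j.+1 < n.-1)%N := lt_pred ijn.
have in' : (i < n.-1)%N by apply: leq_ltn_trans ijn'; exact: leq_addr.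
have jn' : (j < n.-1)%N by apply: leq_ltn_trans ijn'; rewrite addnS ltnW // ltnS leq_addl.
rewrite (coordinateS (Ordinal in')) (coordinateS (Ordinal jn')).
rewrite [(i.+1 + j.+1)%N]addSn (coordinateS (Ordinal ijn')).
by have [_ _ _] := xLen; apply.
Qed.

Lemma coordinate_sum : (0 < n)%N -> \sum_(i < n) coordinate i = 2^-1.
Proof.
move=> n0; have [<- _ _ _] := xLen.
transitivity (\sum_(0 <= i < n.-1.+1) coordinate i); first by rewrite prednK // big_mkord.
rewrite big_nat_recl // add0r big_mkord; apply: eq_bigr => i _.
exact: coordinateS.
Qed.

Lemma coordinate_le1 i : (i < n)%N -> coordinate i <= 1.
Proof.
move=> i_n; have n0 := leq_ltn_trans (leq0n i) i_n.
apply: (@le_trans _ _ 2^-1); last by lra.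
rewrite -(coordinate_sum n0) (bigD1 (Ordinal i_n)) //= lerDl.
by rewrite sumr_ge0 // => j _; exact: coordinate_ge0.
Qed.

(* Rounding up preserves monotonicity and subadditivity; the summand [i] makes
   the exponents strictly increasing, which pins down the tower type. *)
Definition exponent (m i : nat) : nat := (`|Num.ceil (m%:R * coordinate i)| + i)%N.

Let ceil_nat m i : (`|Num.ceil (m%:R * coordinate i)|%N)%:Z = Num.ceil (m%:R * coordinate i).
Proof.
rewrite gez0_abs // ceil_ge0 (lt_le_trans (ltrN10 R)) // mulr_ge0 ?ler0n //.
exact: coordinate_ge0.
Qed.

Lemma exponent_bounds m i :
  m%:R * coordinate i <= (exponent m i)%:R <= m%:R * coordinate i + i.+1%:R.
Proof.
have -> : (exponent m i)%:R = (Num.ceil (m%:R * coordinate i))%:~R + i%:R :> R.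
  by rewrite natrD -{2}ceil_nat.
have := ceil_itv (m%:R * coordinate i); rewrite rmorphB /= => /andP[lo hi].
by rewrite -[i.+1]addn1 natrD; have := ler0n R i; lra.
Qed.

Lemma exponent0 m : exponent m 0 = 0%N.
Proof. by rewrite /exponent /= mulr0 ceil0. Qed.

Lemma exponent_lt m i j : (i < j < n)%N -> (exponent m i < exponent m j)%N.
Proof.
move=> /andP[ij jn]; rewrite /exponent -addnS leq_add //.
rewrite -lez_nat !ceil_nat le_ceil // ler_wpM2l ?ler0n //.
by rewrite coordinate_mono // ltnW.
Qed.

Lemma exponentD m i j : (i + j < n)%N -> no_overflow T i j ->
  (exponent m (i + j) <= exponent m i + exponent m j)%N.
Proof.
move=> ijn no; rewrite /exponent addnACA leq_add2r.
rewrite -lez_nat PoszD !ceil_nat ceil_le_int rmorphD /=.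
apply: (@le_trans _ _ (m%:R * (coordinate i + coordinate j))).
  by rewrite ler_wpM2l ?ler0n // coordinateD.
by rewrite mulrDr lerD // ceil_ge.
Qed.

End LenstraExponents.

(** * Logarithms of the minima and discriminants of the scaled orders *)

Section LogEstimates.
Variable R : realType.

Lemma ln_natX (b e : nat) : (0 < b)%N -> ln ((b ^ e)%:R : R) = e%:R * ln b%:R.
Proof. by move=> b0; rewrite natrX lnXn ?ltr0n // mulr_natl. Qed.

Lemma ln_prod (I : finType) (F : I -> R) : (forall i, 0 < F i) ->
  ln (\prod_i F i) = \sum_i ln (F i).
Proof.
move=> F0; suff [] : 0 < \prod_i F i /\ ln (\prod_i F i) = \sum_i ln (F i) by [].
elim/big_rec2: _ => [|i y z _ [z0 zE]]; first by rewrite ln1.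
by split; [rewrite mulr_gt0 | rewrite lnM ?posrE // zE].
Qed.

(** The bounds of [scaled_lambda] after taking logarithms: [y] is the logarithm of the minimum, [t]
    that of [b ^ e i], [z] the target [m * x_i * L], and [a], [b], [c] are the logarithms of [d],
    [k], [B]. *)
Lemma dist_le (a b c t w y z : R) : a + t <= b + y -> y <= c + t ->
  z <= t -> t <= z + w -> 0 <= w -> `|y - z| <= `|c| + `|a| + `|b| + w.
Proof.
have normN (r : R) : - `|r| <= r by rewrite lerNl -normrN ler_norm.
have := ler_norm b; have := normN a; have := ler_norm c.
have := normr_ge0 a; have := normr_ge0 b; have := normr_ge0 c.
by move=> *; rewrite ler_norml; apply/andP; split; lra.
Qed.

(** The numbers [d], [k], [B] and [b] are fixed before [m], which enters only through the exponents;
    this is why a single error bound [c] serves all [m]. *)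
Lemma orders_with_minima (K : fieldExtType rat) (T : seq nat) (Ks : seq {subfield K})
    (n := \dim {:K}) (x : 'rV[R]_n.-1) :
  is_tower_type T -> tower_degree T = n ->
  path (fun E F : {subfield K} => (E <= F)%VS && (E != F)) 1%AS Ks ->
  last 1%AS Ks = {:K}%AS ->
  T = pairmap (fun E F : {subfield K} => \dim_E F) 1%AS Ks ->
  Len R T n x ->
  exists L c : R, 0 < L /\ forall m : nat, exists O : set K,
    [/\ is_order O, has_tower_type R O T,
        (forall i : 'I_n.-1, `|ln (lambda R i.+1 O) - m%:R * x ord0 i * L| <= c) &
        `|ln (ratr (absdisc O)) - m%:R * L| <= c].
Proof.
move=> hT Tn Ks_path Ks_last TE xLen.
have hT' := hT; rewrite {1}TE in hT'.
have [v [v0 vspan vM vs]] := tower_basis hT' Ks_path.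
rewrite -TE Tn in vspan vM vs.
have n0 : (0 < n)%N by rewrite adim_gt0.
pose X : n.-tuple K := mktuple (fun i : 'I_n => v i).
have Xb : basis_of {:K} X.
  rewrite basisEdim size_tuple leqnn andbT.
  have -> : X = mkseq v n :> seq K by rewrite /= /mkseq -val_enum_ord -map_comp.
  by rewrite -vspan Ks_last.
have nT : \dim {:K} = tower_degree T by [].
have [d d0 dP] := structure_denominator v.
have [k k0 kP] := coord_le_len R X.
pose B : R := \sum_(i < n) d%:R * len R (v i).
have BP (i : 'I_n) : d%:R * len R (v i) <= B.
  by rewrite /B (bigD1 i) //= lerDl sumr_ge0 // => j _; rewrite mulr_ge0 ?ler0n ?len_ge0.
have B0 : 0 < B.
  apply: lt_le_trans (BP (Ordinal n0)); rewrite /= v0 mulr_gt0 ?ltr0n //.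
  exact: len1_gt0.
(* Large enough for [b_big], and at least 2 so that [ln b] is positive. *)
pose b := (Num.Def.archi_bound (k * B)).+2.
have b0 : (0 < b)%N by [].
have b_big : k * B < d%:R * b%:R.
  apply: (lt_le_trans (archi_boundP _)); first by rewrite mulr_ge0 // ltW.
  rewrite -natrM ler_nat (leq_trans (leqW (leqnSn _))) //.
  by rewrite -/b leq_pmull.
pose L : R := ln b%:R.
have L0 : 0 < L by rewrite /L ln_gt0 // ltr1n.
pose D0 : R := ratr `|\det (trace_form X)|.
have D0_gt0 : 0 < D0 by rewrite /D0 ltr0q normr_gt0 det_trace_form_neq0.
pose ld := ln (d%:R : R).
have d0R : 0 < d%:R :> R by rewrite ltr0n.
(* [c1] bounds the error for the minima and [c2] that for the discriminant, where every multiplier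
   enters squared. *)
pose c1 := `|ln B| + `|ld| + `|ln k| + n%:R * L.
pose c2 := (\sum_(i < n) 2 * (`|ld| + n%:R * L)) + `|ln D0|.
have nL0 : 0 <= n%:R * L by rewrite mulr_ge0 ?ler0n // ltW.
have c1_ge0 : 0 <= c1 by rewrite !addr_ge0.
have c2_ge0 : 0 <= c2 by rewrite addr_ge0 ?sumr_ge0 // => i _; rewrite mulr_ge0 ?addr_ge0 ?ler0n.
exists L, (c1 + c2); split=> // m; pose e := exponent x m.
have e_adm : admissible K T e.
  split; first exact: exponent0.
    by move=> i j; exact: (exponent_lt xLen).
  by move=> i j; exact: (exponentD xLen).
have eL i : (i < n)%N -> m%:R * coordinate x i * L <= (e i)%:R * L /\
    (e i)%:R * L <= m%:R * coordinate x i * L + n%:R * L.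
  move=> i_n; have /andP[lo hi] := exponent_bounds xLen m i.
  rewrite -mulrDl !ler_pM2r //; split=> //; apply: le_trans hi _.
  by rewrite lerD2l ler_nat.
exists (diag_lattice X (scaling d b e)); split.
- exact: (scaled_order v0 nT Xb vM d0 b0 e_adm dP).
- exact: (scaled_tower_type v0 Xb d0 b0 e_adm k0 kP BP b_big Ks_path Ks_last TE vs).
- move=> i; have i_n : (i.+1 < n)%N by have := ltn_ord i; rewrite -ltnS prednK.
  have [lo hi] := scaled_lambda v0 Xb d0 b0 e_adm k0 kP BP (i_n : (0 < i.+1 < n)%N).
  set l := lambda _ _ _ in lo hi *.
  have be0 : 0 < (b ^ e i.+1)%:R :> R by rewrite ltr0n expn_gt0 b0.
  have l0 : 0 < l by rewrite -(pmulr_rgt0 _ k0); apply: lt_le_trans lo; rewrite mulr_gt0.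
  rewrite -ler_ln ?posrE ?mulr_gt0 // !lnM ?posrE // ln_natX // in lo.
  rewrite -ler_ln ?posrE ?mulr_gt0 // lnM ?posrE // ln_natX // in hi.
  have [elo ehi] := eL _ i_n; rewrite coordinateS in elo ehi.
  apply: (@le_trans _ _ c1); last by rewrite lerDl.
  exact: dist_le lo hi elo ehi nL0.
rewrite scaled_absdisc // rmorphM rmorphXn rmorph_prod /= -/D0.
have u0 i : (0 < scaling d b e i)%N by exact: scaling_gt0.
under eq_bigr do rewrite ratr_nat.
rewrite lnM ?posrE ?exprn_gt0 ?prodr_gt0 // => [|i _]; last by rewrite ltr0n.
rewrite lnXn ?prodr_gt0 // => [|i _]; last by rewrite ltr0n.
rewrite ln_prod => [|i]; last by rewrite ltr0n.
have lnu (i : 'I_n) : `|ln (scaling d b e i)%:R - m%:R * coordinate x i * L| <= `|ld| + n%:R * L.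
  rewrite /scaling; case: eqP => [->|_]; first by rewrite ln1 mulr0 mul0r subrr normr0 addr_ge0.
  rewrite natrM lnM ?posrE ?ltr0n ?expn_gt0 ?b0 // ln_natX // -/L -/ld -addrA.
  have [elo ehi] := eL _ (ltn_ord i); apply: le_trans (ler_normD _ _) _.
  by rewrite lerD2l ger0_norm ?subr_ge0 // lerBlDl.
(* The coordinates sum to one half, which the square in the discriminant compensates. *)
have -> : m%:R * L = \sum_(i < n) 2 * (m%:R * coordinate x i * L).
  rewrite -mulr_sumr -mulr_suml -mulr_sumr (coordinate_sum xLen n0).
  by field.
rewrite -[(\sum_i _) *+ 2]mulr_natl mulr_sumr addrAC -sumrB.
apply: le_trans (ler_normD _ _) _; rewrite ler_wpDl // lerD2r.
apply: le_trans (ler_norm_sum _ _ _) _; apply: ler_sum => i _.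
by rewrite -mulrBr normrM ger0_norm // ler_wpM2l.
Qed.

End LogEstimates.

(** * Convergence along the constructed orders *)

Theorem theorem1p24 (R : realType) (K : fieldExtType rat) (T : seq nat) (n : nat)
    (hT : is_tower_type T) (hTn : tower_degree T = n) (hK : \dim {:K} = n)
    (hne : orders_of_type R K T !=set0) :
  Len R T n `<=` Spe R K n (orders_of_type R K T).
Proof.
case: n / hK hTn => hTn x xLen.
have [_ [P [_ [Ks [Ks_path Ks_last _ TE]] _]]] := hne.
have [L [c [L0 /choice[lat latP]]]] := orders_with_minima hT hTn Ks_path Ks_last TE xLen.
have Oord m : is_order (lat m) by have [] := latP m.
have disc m : absdisc (xget set0 (iso_class (lat m))) = absdisc (lat m).
  apply: (iso_class_invariants R (Oord m) _).2.
  by apply: xgetPex; exists (lat m); exact: iso_class_refl.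
have x01 i : 0 <= x ord0 i <= 1.
  rewrite -coordinateS (coordinate_ge0 xLen) (coordinate_le1 xLen) //.
  by have := ltn_ord i; rewrite -ltnS prednK // adim_gt0.
apply: (@Spe_seq _ _ _ _ (fun m => iso_class (lat m))).
- by move=> m; exists (lat m); have [? ? _ _] := latP m.
- move=> A; have [M MP] := @ratio_approx R L c 1 A L0 ltr01.
  exists M; rewrite disc; have [_ _ _ Dm] := latP M.
  (* With [y = 0] the condition on [a] becomes trivial, and [ratio_approx] yields just the growth of
     the discriminants. *)
  have m00 : `|M%:R * 0 * L - M%:R * 0 * L| <= c by rewrite subrr normr0 (le_trans _ Dm).
  by have [] := MP M (leqnn M) _ 0 _ _ m00 Dm; rewrite // lexx ler01.
move=> eps eps0; have [M MP] := @ratio_approx R L c eps 0 L0 eps0.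
exists M => m Mm i; have [_ _ lm Dm] := latP m.
rewrite log_minima_iso_class // mxE.
by have [] := MP m Mm _ _ _ (x01 i) (lm i) Dm.
Qed.
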